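(* Let $\Delta,d,k$ be positive integers with $\Delta\ge d+3$. Then the node-averaged complexity of the LCL problem $\Pi^{2.5}_{\Delta,d,k}$ is $O(n^{\alpha_1})$, where $$\alpha_1=\frac{1}{\sum_{j=0}^{k-1}(2-x)^j}\qquad\text{and}\qquad x=\frac{\log(\Delta-d-1)}{\log(\Delta-1)} .$$
   Context: Model. In the LOCAL model, the $n$-node input graph is a communication network; computation proceeds in synchronous rounds, in each of which each node may send an arbitrarily large message to each neighbor and perform arbitrary local computation. Nodes know $n$. In the deterministic setting nodes have unique identifiers from $\{1,\dots,n^{O(1)}\}$; in the randomized setting nodes have private random bits. For an algorithm $\mathcal A$ on $G$, $T_v^G(\mathcal A)$ is the number of rounds after which node $v$ terminates (fixes its output). The node-averaged complexity of $\mathcal A$ is $\max_{G}\frac{1}{|V(G)|}\mathbb E\big[\sum_{v}T_v^G(\mathcal A)\big]$ as a function of $n$, the maximum being over all $n$-node trees of maximum degree at most $\Delta$ (with all inputs and identifiers); the node-averaged complexity of a problem is the best one achieved by an algorithm solving it. The bound applies to deterministic (hence also randomized) complexity. $k$-hierarchical $2\frac12$-coloring. There are no input labels. Each node of a tree gets a level in $\{1,\dots,k+1\}$: for $i=1,\dots,k$ in this order, let $V_i$ be the set of nodes of degree at most $2$ in the remaining tree; these have level $i$ and are removed; the nodes remaining at the end have level $k+1$. Each node outputs one label of $\{W,B,E,D\}$ such that: (i) no node of level $1$ is labeled $E$; (ii) all nodes of level $k+1$ are labeled $E$; (iii) a node of level $2\le i\le k$ is labeled $E$ if and only if it is adjacent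 to a lower-level node labeled $W$, $B$ or $E$; (iv) a node of level $1\le i\le k$ labeled $W$ (resp. $B$) has no neighbor of level $i$ labeled $W$ (resp. $B$) or $D$; (v) nodes of level $k$ are not labeled $D$ (so those not labeled $E$ are properly 2-colored with $W,B$). The problem $\Pi^{2.5}_{\Delta,d,k}$. Defined on trees of maximum degree at most $\Delta$; each node has an input label $\mathsf{Active}$ (active node) or $\mathsf{Weight}$ (weight node). Each active node outputs a label of $\{W,B,E,D\}$. Each weight node outputs a label of $\{\mathsf{Decline},\mathsf{Connect},\mathsf{Copy}\}$, and if it outputs $\mathsf{Copy}$ it additionally outputs a label of $\{W,B,E,D\}$, its secondary output. The output is correct if: 1. each connected component induced by active nodes satisfies the constraints of $k$-hierarchical $2\frac12$-coloring (levels computed in that component); 2. each weight node adjacent to at least one active node outputs $\mathsf{Connect}$ or $\mathsf{Copy}$; 3. for each weight node $v$ that outputs $\mathsf{Connect}$, at least two neighbors of $v$ are active or output $\mathsf{Connect}$; 4. for each node $v$ that outputs $\mathsf{Copy}$, at most $d$ neighbors of $v$ output $\mathsf{Decline}$; 5. if a weight node $v$ that outputs $\mathsf{Copy}$ has an active neighbor, then its secondary output equals the output of at least one active neighbor of $v$; and any two adjacent weight nodes that both output $\mathsf{Copy}$ have identical secondary outputs. *)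

(* Defs.v *)
From HB Require Import structures.
From mathcomp Require Import all_boot all_order all_algebra.
From mathcomp Require Import all_classical all_reals all_analysis.

Set Implicit Arguments.
Unset Strict Implicit.
Unset Printing Implicit Defensive.

Import Order.TTheory GRing.Theory Num.Theory.

Local Open Scope nat_scope.

(* [3 <= size c] because an edge traversed back and forth is a [ucycle] of
   size 2. *)
Definition is_tree (V : finType) (e : rel V) : Prop :=
  [/\ 0 < #|V|, symmetric e, irreflexive e, forall u v, connect e u v
    & forall c : seq V, ucycle e c -> ~~ (3 <= size c)].

Definition max_degree_le (V : finType) (e : rel V) (Delta : nat) : Prop :=
  forall v, #|[set u | e v u]| <= Delta.

(* [port v] lists the neighbors of [v]; a node refers to its neighbors only by
   their position in this list, whose order is chosen by the adversary. *)
Record network (I : Type) := Network {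
  node : finType;
  edge : rel node;
  port : node -> seq node;
  ident : node -> nat;
  input : node -> I }.

(* Identifiers range over {1, ..., n ^ c}. *)
Definition wf_network (I : Type) (c : nat) (G : network I) : Prop :=
  [/\ forall v, perm_eq (port v) (enum (@edge I G v)),
      injective (@ident I G)
    & forall v : node G, 1 <= ident v <= #|node G| ^ c].

(* [init n id i deg] is the initial state of a node: it knows the number [n] of
   nodes, its identifier, its input and its degree.  [send s p] is the message
   sent through port [p]; [recv s ms] is the next state when [nth _ ms p] is
   the message received through port [p].  There are no computability or size
   restrictions. *)
Record algorithm (I O : Type) := Algorithm {
  state : Type;
  message : Type;
  init : nat -> nat -> I -> nat -> state;
  send : state -> nat -> message;
  recv : state -> seq message -> state;
  output : state -> option O }.

Section Execution.
Context {I O : Type} (A : algorithm I O) (G : network I).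

Fixpoint state_at (t : nat) (v : node G) : state A :=
  if t is t'.+1 then
    recv (state_at t' v)
      [seq send (state_at t' u) (index v (port u)) | u <- port v]
  else init A #|node G| (ident v) (input v) (size (port v)).

Definition has_output (t : nat) (v : node G) : bool :=
  isSome (output (state_at t v)).

(* The output is fixed the first time it is defined.  The node may still
   forward messages afterwards, but it cannot revise that output. *)
Definition final_output (v : node G) (o : O) : Prop :=
  exists2 t, output (state_at t v) = Some o &
    forall s, s < t -> has_output s v = false.

(* Equal to +oo when [v] never fixes an output. *)
Definition termination_time (R : realType) (v : node G) : \bar R :=
  ereal_inf [set (t%:R)%:E | t in [set t | has_output t v]].

End Execution.

(* [instance e] says on which graphs the problem is posed. *)
Record problem (I O : Type) := Problem {
  instance : forall V : finType, rel V -> Prop;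
  correct : forall V : finType, rel V -> (V -> I) -> (V -> O) -> Prop }.

Section Complexity.
Context {I O : Type} (P : problem I O).

Definition solves (A : algorithm I O) (c : nat) : Prop :=
  forall G : network I, wf_network c G -> instance P (@edge I G) ->
    exists2 out : node G -> O,
      forall v, final_output A v (out v) &
      correct P (@edge I G) (@input I G) out.

Definition average_time (R : realType) (A : algorithm I O) (G : network I) :
    \bar R :=
  (((#|node G|%:R)^-1)%:E * \sum_(v : node G) termination_time A R v)%E.

Definition node_averaged_complexity (R : realType) (A : algorithm I O)
    (c n : nat) : \bar R :=
  ereal_sup [set y | exists G : network I,
    [/\ wf_network c G, instance P (@edge I G), #|node G| = n
      & y = average_time R A G]].

(* The deterministic node-averaged complexity of [P] is O(f), whatever the
   exponent [c] of the polynomial identifier space. *)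
Definition node_averaged_bigO (R : realType) (f : nat -> R) : Prop :=
  forall c : nat, 0 < c ->
    exists2 A : algorithm I O, solves A c &
    exists C : R, forall n : nat, 0 < n ->
      (node_averaged_complexity R A c n <= (C * f n)%:E)%E.

End Complexity.

Inductive label := LabW | LabB | LabE | LabD.

Section Hierarchical.
Variables (V : finType) (e : rel V).

(* What is left of the subgraph induced by [S] after [i] rounds of removing the
   nodes of degree at most 2. *)
Fixpoint remaining (S : {set V}) (i : nat) : {set V} :=
  if i is i'.+1 then
    let S' := remaining S i' in [set v in S' | 2 < #|[set u in S' | e v u]|]
  else S.

(* [find] returns [k] when [v] survives all [k] rounds, so that the level is
   then [k.+1]. *)
Definition level (k : nat) (S : {set V}) (v : V) : nat :=
  (find (fun i => v \notin remaining S i.+1) (iota 0 k)).+1.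

Definition hierarchical_coloring (k : nat) (S : {set V}) (lab : V -> label) :
    Prop :=
  let L := level k S in
  forall v, v \in S ->
  [/\ L v = 1 -> lab v <> LabE,
      L v = k.+1 -> lab v = LabE,
      2 <= L v <= k ->
        (lab v = LabE <->
         exists u, [/\ u \in S, e v u, L u < L v
           & [\/ lab u = LabW, lab u = LabB | lab u = LabE]]),
      1 <= L v <= k ->
        forall u, u \in S -> e v u -> L u = L v ->
          (lab v = LabW -> lab u <> LabW /\ lab u <> LabD) /\
          (lab v = LabB -> lab u <> LabB /\ lab u <> LabD)
    & L v = k -> lab v <> LabD].

End Hierarchical.

Inductive node_input := Active | Weight.

Inductive node_output :=
  | Color of label
  | Decline
  | Connect
  | Copy of label.

Definition is_active (i : node_input) : bool :=
  if i is Active then true else false.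
Definition is_color (o : node_output) : bool :=
  if o is Color _ then true else false.
Definition is_decline (o : node_output) : bool :=
  if o is Decline then true else false.
Definition is_connect (o : node_output) : bool :=
  if o is Connect then true else false.
Definition is_copy (o : node_output) : bool :=
  if o is Copy _ then true else false.

(* Only used on active nodes, whose output is a [Color]; the value in the other
   cases is irrelevant. *)
Definition color_of (o : node_output) : label :=
  if o is Color l then l else LabD.

Section Weighted.
Variables (V : finType) (e : rel V) (inp : V -> node_input).

Definition active (v : V) : bool := is_active (inp v).

Definition active_component (v : V) : {set V} :=
  [set w | connect (fun a b => [&& e a b, active a & active b]) v w].

Definition weighted_correct (d k : nat) (out : V -> node_output) : Prop :=
  (forall v, is_color (out v) = active v) /\
  [/\ forall v, active v ->
        hierarchical_coloring e k (active_component v) (color_of \o out),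
      forall v, ~~ active v -> (exists2 u, e v u & active u) ->
        is_connect (out v) || is_copy (out v),
      forall v, ~~ active v -> is_connect (out v) ->
        2 <= #|[set u | e v u && (active u || is_connect (out u))]|,
      forall v, is_copy (out v) ->
        #|[set u | e v u && is_decline (out u)]| <= d
    & (forall v l, ~~ active v -> out v = Copy l ->
          (exists2 u, e v u & active u) ->
          exists u, [/\ e v u, active u & out u = Color l]) /\
        (forall u v l m, ~~ active u -> ~~ active v -> e u v ->
          out u = Copy l -> out v = Copy m -> l = m)].

End Weighted.

Definition Pi25 (Delta d k : nat) : problem node_input node_output :=
  {| instance V e := is_tree e /\ max_degree_le e Delta;
     correct V e inp out := weighted_correct e inp d k out |}.

Local Open Scope ring_scope.

Definition efficiency (R : realType) (Delta d : nat) : R :=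
  ln (Delta%:R - d%:R - 1) / ln (Delta%:R - 1).

Definition alpha1 (R : realType) (Delta d k : nat) : R :=
  (\sum_(0 <= j < k) (2 - efficiency R Delta d) ^+ j)^-1.

(* Main.v *)
From HB Require Import structures.
Require Import Defs.
From mathcomp Require Import all_boot all_order all_algebra.
From mathcomp Require Import all_classical all_reals all_analysis.
From mathcomp Require Import zify ring lra.

Set Implicit Arguments.
Unset Strict Implicit.
Unset Printing Implicit Defensive.

Import Order.TTheory GRing.Theory Num.Theory.

Local Open Scope nat_scope.

(** Active nodes.  The coloring is computed level by level.  Among the nodes of
    level [l] without a lower neighbor labeled W, B or E, a connected component
    with at most [gamma_l] nodes is 2-colored and a larger one is labeled D; a
    node that has such a neighbor is labeled E at once.  At most two edges leave
    a component upwards, and every node of level [l + 1] that is still undecided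
    is adjacent to a component with more than [gamma_l] nodes, so the number of
    undecided nodes drops by a factor [gamma_l / 2] from one stage to the next.

    Weight nodes.  Call a weight node a contact if it has an active neighbor.
    The weight nodes on paths of logarithmic length between two contacts output
    Connect.  Any other contact [v] copies an active neighbor to the region
    obtained by letting every node decline its [d] largest subtrees, all seen
    from [v].  Subtree sizes are at least halved at each step, so the region is
    exhausted at logarithmic depth; by concavity of [s `^ x], where
    [(Delta - 1) `^ x = Delta - d - 1], it takes only [O(s `^ x)] of the [s]
    nodes that [v] sees.  All other weight nodes decline.

    Complexity.  By concavity again, if [N] active nodes are undecided then
    [O(N `^ (1 - x) * n `^ x)] nodes wait for them.  With
    [gamma_l = 2 * n `^ (alpha * (2 - x) ^+ (l - 1))] every stage contributes
    [O(n `^ (1 + alpha))] to the sum of the running times, and no component of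
    level [k] is larger than [gamma_k]. *)

(** * Trees *)

(** Breadth-first distance. Connectedness of [e] is not assumed because the lemma is also applied to
    the edges inside a single component. *)
Lemma dist_exists (V : finType) (e : rel V) (r : V) :
  exists d : V -> nat,
    [/\ d r = 0,
        forall v, connect e r v -> v != r ->
          exists u, [/\ e u v, connect e r u & d v = (d u).+1]
      & forall u v, connect e r u -> e u v -> d v <= (d u).+1].
Proof.
pose P v n := [exists p : n.-tuple V, path e r p && (last r p == v)].
(* The implication lets the minimum exist at unreachable nodes as well, where it is 0. *)
have exP v : exists n, connect e r v ==> P v n.
  case: (boolP (connect e r v)) => [/connectP[p ep lp]|_]; last by exists 0.
  exists (size p); apply/existsP; exists (in_tuple p).
  by rewrite ep lp eqxx.
pose d v := ex_minn (exP v).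
have dP v : connect e r v -> P v (d v).
  by rewrite /d; case: ex_minnP => n /implyP.
have d_le v p : path e r p -> last r p = v -> d v <= size p.
  move=> ep lp; rewrite /d; case: ex_minnP => n _; apply.
  apply/implyP => _; apply/existsP; exists (in_tuple p).
  by rewrite ep lp eqxx.
exists d; split.
- by apply/eqP; rewrite -leqn0 (d_le r [::]).
- move=> v rv vr; have /existsP[p /andP[ep /eqP lp]] := dP v rv.
  have sp := size_tuple p; move: sp ep lp.
  case/lastP: (tval p) => [|q w]; first by move=> _ _ /= vE; rewrite vE eqxx in vr.
  rewrite size_rcons rcons_path last_rcons => dv /andP[eq ew] wv.
  rewrite {}wv in ew; have cq : connect e r (last r q) by apply/connectP; exists q.
  exists (last r q); split=> //; apply/eqP; rewrite eqn_leq -{2}dv ltnS.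
  rewrite (d_le _ q) // andbT.
  have /existsP[p' /andP[ep' /eqP lp']] := dP _ cq.
  rewrite -[X in _ <= X.+1](size_tuple p') -(size_rcons _ v).
  by rewrite d_le ?last_rcons // rcons_path ep' lp'.
- move=> u v ru euv; have /existsP[p /andP[ep /eqP lp]] := dP _ ru.
  rewrite -[X in _ <= X.+1](size_tuple p) -(size_rcons _ v).
  by rewrite d_le ?last_rcons // rcons_path ep lp.
Qed.

(* If [v] had two neighbors no farther from [r] than itself, both could be
   joined to [r] while avoiding [v], which closes a cycle through [v]. *)
Lemma tree_layers (V : finType) (e : rel V) (r : V) : is_tree e ->
  exists d : V -> nat,
    [/\ d r = 0,
        forall v, v != r -> exists2 u, e v u & d v = (d u).+1,
        forall u v, e u v -> d u = (d v).+1 \/ d v = (d u).+1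
      & forall v a b, e v a -> e v b -> d a < d v -> d b < d v -> a = b].
Proof.
case=> _ esym eirr econn acyc.
have [d [dr dpar dle]] := dist_exists e r.
have d0 v : d v = 0 -> v = r.
  move=> dv; apply/eqP/negPn/negP => vr.
  by have [u [_ _]] := dpar v (econn r v) vr; rewrite dv.
have par v : v != r -> exists2 u, e v u & d v = (d u).+1.
  by move=> /(dpar v (econn r v))[u [euv _ dv]]; exists u => //; rewrite esym.
pose e' v := [rel a b | [&& e a b, a != v & b != v]].
have toroot v : v != r -> forall n a, d a <= n -> a != v -> d a <= d v ->
    connect (e' v) a r.
  move=> vr; elim=> [|n IH] a.
    by rewrite leqn0 => /eqP /d0 ->; rewrite connect0.
  move=> dan av dav; have [->|ar] := eqVneq a r; first exact: connect0.
  have [u eau da] := par a ar.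
  have uv : u != v by apply/eqP => uv; move: dav; rewrite da uv ltnn.
  apply: (connect_trans (y := u)); first by apply: connect1; rewrite /= eau av uv.
  by move: dan dav; rewrite da ltnS => dun duv; apply: IH => //; apply: ltnW.
have low1 v a b : e v a -> e v b -> d a <= d v -> d b <= d v -> a = b.
  move=> eva evb dav dbv; apply/eqP/negPn/negP => ab.
  have av : a != v by apply/eqP => av; rewrite av eirr in eva.
  have bv : b != v by apply/eqP => bv; rewrite bv eirr in evb.
  have [vr|vr] := eqVneq v r.
    move: dav; rewrite vr dr leqn0 => /eqP /d0 ar.
    by rewrite ar vr eqxx in av.
  have e'sym : connect_sym (e' v).
    by apply: sym_connect_sym => x y /=; rewrite esym; case: (e y x); rewrite //= andbC.
  have cab : connect (e' v) a b.
    apply: connect_trans (toroot v vr _ a (leqnn _) av dav) _.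
    by rewrite e'sym; apply: toroot (leqnn _) bv dbv.
  case/connectP: cab => p0 /shortenP[p ep up _] lp {p0}.
  have vp : all (fun x => x != v) p.
    elim: p a ep {up lp eva ab av dav} => //= x p IH a /andP[/and3P[_ _ xv] ep].
    by rewrite xv (IH _ ep).
  have ep' : path e a p.
    by apply: sub_path ep => x y /= /and3P[].
  case: p lp ep up vp ep' => [|x p] lp ep up vp ep'; first by rewrite lp eqxx in ab.
  suff uc : ucycle e (v :: a :: x :: p) by have := acyc _ uc.
  apply/andP; split.
    by move: lp ep' => /= lp /andP[-> ep']; rewrite rcons_path eva ep' -lp esym evb.
  rewrite cons_uniq up andbT inE negb_or eq_sym av /=.
  by apply/negP => /(allP vp); rewrite eqxx.
exists d; split=> //.
- move=> u v euv.
  wlog duv : u v euv / d u <= d v => [H|].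
    case/orP: (leq_total (d u) (d v)) => /H; first exact.
    by rewrite esym => /(_ euv) []; [right|left].
  have vr : v != r.
    apply/eqP => vr; move: duv; rewrite vr dr leqn0 => /eqP /d0 ur.
    by rewrite ur vr eirr in euv.
  have [w evw dv] := par v vr; right.
  suff -> : u = w by [].
  by apply: (low1 v) => //; [rewrite esym|rewrite dv].
- by move=> v a b eva evb /ltnW dav /ltnW dbv; apply: (low1 v).
Qed.

(** By [tree_layers] adjacent nodes lie in consecutive layers, so the parity of the layer is a
    proper coloring. *)
Lemma tree_two_coloring (V : finType) (e : rel V) : is_tree e ->
  exists c : V -> bool, forall u v, e u v -> c v = ~~ c u.
Proof.
move=> et; have [/card_gt0P[r _] _ _ _ _] := et.
have [d [_ _ d1 _]] := tree_layers r et.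
exists (fun v => odd (d v)) => u v /d1[] ->; last by [].
by rewrite /= negbK.
Qed.

(* A connected set [C] of nodes spans at least [#|C| - 1] edges, so if its nodes
   have degree at most 2 then at most two edges leave it. *)
Lemma component_boundary (V : finType) (e : rel V) (U W : {set V}) (g : nat) :
  symmetric e -> [disjoint U & W] ->
  (forall v, v \in U -> #|[set u in U :|: W | e v u]| <= 2) ->
  (forall w, w \in W -> exists u, [/\ u \in U, e w u &
     g <= #|[set z | connect [rel a b | [&& e a b, a \in U & b \in U]] u z]|]) ->
  g * #|W| <= 2 * #|U|.
Proof.
move=> esym dUW deg2 big.
pose e' := [rel a b | [&& e a b, a \in U & b \in U]].
have e'sym : symmetric e' by move=> a b /=; rewrite esym andbCA andbC -andbA.
have csym : connect_sym e' by apply: sym_connect_sym.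
have inU a b : a \in U -> connect e' a b -> b \in U.
  move=> aU /connectP[p ep ->]; elim: p a aU ep => //= x p IH a aU /andP[/and3P[_ _ xU]].
  exact: IH.
pose C u := [set z | connect e' u z].
have out_le2 u : u \in U ->
    \sum_(z in C u) #|[set w in W | e z w]| <= 2.
  move=> uU; have [d [du dpar _]] := dist_exists e' u.
  have CU : {subset C u <= U} by move=> z; rewrite inE; apply: inU.
  have uC : u \in C u by rewrite inE connect0.
  have split_deg z : z \in C u ->
      #|[set w in C u | e z w]| + #|[set w in W | e z w]| <= 2.
    move=> zC; apply: leq_trans (deg2 z (CU z zC)).
    rewrite -cardsUI (_ : _ :&: _ = finset.set0) ?cards0 ?addn0.
      apply/subset_leq_card/fintype.subsetP => w.
      by rewrite !inE => /orP[/andP[cw ->]|/andP[-> ->]]; rewrite ?orbT // CU // inE.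
    apply/setP => w; rewrite !inE; apply/negP => /andP[/andP[cw _] /andP[wW _]].
    have wU : w \in U by apply: CU; rewrite inE.
    by have := disjointFr dUW wU; rewrite wW.
  (* Edges of the component are oriented towards [u]. Every node but [u] has an outgoing edge and
     every edge counts at both ends, so the inner degrees sum to at least [2 * (#|C u| - 1)]. *)
  pose low z w := [&& w \in C u, e z w & d w < d z].
  have lowE : \sum_(z in C u) \sum_(w in C u) low w z
            = \sum_(z in C u) \sum_(w in C u) low z w by rewrite exchange_big.
  have low_ge : #|C u|.-1 <= \sum_(z in C u) \sum_(w in C u) low z w.
    rewrite (cardsD1 u) uC /= -sum1_card [X in _ <= X](bigD1 u) //=.
    apply: leq_trans (leq_addl _ _); rewrite big_mkcond [X in _ <= X]big_mkcond /=.
    apply: leq_sum => z _; rewrite !inE andbC; case: ifP => // /andP[cz zu].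
    have [w [/and3P[ewz wU zU] cw dz]] := dpar z cz zu.
    rewrite (bigD1 w) /=; last by rewrite inE.
    by rewrite /low inE cw esym ewz dz ltnS leqnn.
  have deg_ge : \sum_(z in C u) \sum_(w in C u) low z w
      + \sum_(z in C u) \sum_(w in C u) low w z
      <= \sum_(z in C u) #|[set w in C u | e z w]|.
    rewrite -big_split; apply: leq_sum => z zC /=.
    rewrite -big_split -sum1dep_card [X in _ <= X]big_mkcondr; apply: leq_sum => w wC.
    rewrite /low zC wC esym /=; case: ifP => //= _.
    by case: ltngtP.
  have := leq_sum (index_enum V) split_deg; rewrite big_split sum_nat_const /=.
  have : 0 < #|C u| by apply/card_gt0P; exists u.
  move: low_ge deg_ge; rewrite lowE; lia.
(* Each node of [W] is charged to one adjacent component with at least [g] nodes, named by its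
   representative [r]. By [out_le2] a component is charged at most twice. *)
pose f w := odflt w [pick u | [&& u \in U, e w u & g <= #|C u|]].
have fP w : w \in W -> [/\ f w \in U, e w (f w) & g <= #|C (f w)|].
  move=> wW; rewrite /f; case: pickP => [x /and3P[]//|H].
  by have [u [uU ewu gu]] := big w wW; have := H u; rewrite uU ewu gu.
pose r v := fingraph.root e' v.
rewrite -!sum1_card (partition_big (fun w => r (f w)) xpredT) //=.
rewrite [X in _ <= _ * X](partition_big r xpredT) //= !big_distrr /=.
apply: leq_sum => rho _; rewrite !sum1dep_card.
case: (set_0Vmem [set w in W | r (f w) == rho]) => [->|[w0]].
  by rewrite cards0 muln0.
rewrite inE => /andP[/fP[f0U ef0 gf0] /eqP r0].
have CE : C (f w0) = [set u in U | r u == rho].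
  apply/setP => z; rewrite !inE -r0 /r root_connect // csym.
  by case: (boolP (connect e' z (f w0))) => [zc|]; rewrite ?andbF //= andbT (inU _ _ f0U) // csym.
rewrite -CE mulnC leq_mul //; apply: leq_trans (out_le2 _ f0U).
under [X in _ <= X]eq_bigr => z _ do rewrite -sum1dep_card.
rewrite (exchange_big_dep (mem W)) /=; last by move=> ? ? _ /andP[].
rewrite -sum1dep_card [X in X <= _]big_mkcondr; apply: leq_sum => w wW.
case: ifP => // /eqP rw; have [fU ef _] := fP w wW.
by rewrite (bigD1 (f w)) //= CE inE fU rw eqxx wW esym ef.
Qed.

(** * Views and locality *)

(** Full information: the history of what a node and, recursively, its neighbors knew. Neighbors are
    listed in port order; they are told apart by identifiers. *)
Inductive view (I : Type) :=
  | InitView of nat & nat & I & nat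
  | NextView of view I & seq (view I).

Fixpoint view_at (I : Type) (G : network I) (t : nat) (v : node G) : view I :=
  if t is t'.+1 then NextView (view_at t' v) [seq view_at t' u | u <- port v]
  else InitView #|node G| (ident v) (input v) (size (port v)).

(** The two networks are arbitrary, so the value is a function of the view alone. This is why the
    rules below are stated uniformly for all networks. *)
Definition local (I X : Type) (r : nat) (F : forall G : network I, node G -> X) :=
  forall (G G' : network I) (v : node G) (v' : node G'),
    view_at r v = view_at r v' -> F G v = F G' v'.

Section Locality.
Variable I : Type.
Implicit Types G : network I.

Lemma view_at_le G G' (v : node G) (v' : node G') (s t : nat) :
  s <= t -> view_at t v = view_at t v' -> view_at s v = view_at s v'.
Proof.
elim: t => [|t IH]; first by rewrite leqn0 => /eqP ->.
by rewrite leq_eqVlt => /orP[/eqP ->//|st] [/(IH st)].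
Qed.

Lemma view_at_time G G' (v : node G) (v' : node G') (s t : nat) :
  view_at s v = view_at t v' -> s = t.
Proof. by elim: s t => [|s IH] [|t] //= [] /IH ->. Qed.

Lemma view_at_card G G' (v : node G) (v' : node G') (t : nat) :
  view_at t v = view_at t v' -> #|node G| = #|node G'|.
Proof. by move/(view_at_le (leq0n t)) => []. Qed.

Lemma local_le X (r s : nat) (F : forall G, node G -> X) :
  r <= s -> local r F -> local s F.
Proof. by move=> rs lF G G' v v' /(view_at_le rs); apply: lF. Qed.

Lemma local_ports X r (F : forall G, node G -> X) :
  local r F -> local r.+1 (fun G v => [seq F G u | u <- port v]).
Proof.
move=> lF G G' v v' [_]; elim: (port v) (port v') => [|u s IH] [|u' s'] //=.
by case=> /lF -> /IH ->.
Qed.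

Lemma local_ident : local 0 (fun G => @ident I G).
Proof. by move=> G G' v v' []. Qed.

Lemma local_input : local 0 (fun G => @input I G).
Proof. by move=> G G' v v' []. Qed.

(** How a node learns what the nodes within distance [t] announce. A value is repeated once per
    walk, which does no harm. *)
Fixpoint gather X (F : forall G, node G -> seq X) (t : nat) G (v : node G) : seq X :=
  if t is t'.+1 then F G v ++ flatten [seq gather F t' u | u <- port v] else F G v.

Lemma local_gather X r (F : forall G, node G -> seq X) t :
  local r F -> local (r + t) (gather F t).
Proof.
move=> lF; elim: t => [|t IH]; first by rewrite addn0.
rewrite addnS; move=> G G' v v' E /=.
rewrite (local_le _ lF E); last by lia.
by congr (_ ++ flatten _); apply: (local_ports IH) E.
Qed.

Lemma mem_gather (X : eqType) (F : forall G, node G -> seq X) t G (v u : node G) p x :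
  (forall w, perm_eq (port w) (enum (@edge I G w))) ->
  path (@edge I G) v p -> last v p = u -> size p <= t -> x \in F G u ->
  x \in gather F t v.
Proof.
move=> wf; elim: t v p => [|t IH] v [|w p] //=; first by move=> _ ->.
  by move=> _ -> _ xF; rewrite mem_cat xF.
move=> /andP[evw ep] lp sp xF; rewrite mem_cat; apply/orP; right.
apply/flatten_mapP; exists w; last exact: IH ep lp sp xF.
by rewrite (perm_mem (wf v)) mem_enum.
Qed.

Lemma gather_mem (X : eqType) (F : forall G, node G -> seq X) t G (v : node G) x :
  x \in gather F t v -> exists u, x \in F G u.
Proof.
elim: t v => [|t IH] v /=; first by exists v.
rewrite mem_cat => /orP[|/flatten_mapP[w _ /IH]//]; by exists v.
Qed.

End Locality.

(* The algorithm floods full views; a node outputs [o] as soon as some stage [i]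
   with [r n i <= t] of a network compatible with its view assigns [o] to it. *)
Lemma simulate (I O : Type) (P : problem I O) (c K : nat)
    (st : nat -> forall G : network I, node G -> option O) (r : nat -> nat -> nat) :
  (forall i (G G' : network I) (v : node G) (v' : node G'),
     view_at (r #|node G| i) v = view_at (r #|node G| i) v' ->
     st i G v = st i G' v') ->
  (forall G : network I, wf_network c G -> instance P (@edge I G) ->
     forall (v : node G) i j o, i <= j -> st i G v = Some o -> st j G v = Some o) ->
  (forall G : network I, wf_network c G -> instance P (@edge I G) ->
     exists2 out : node G -> O, forall v, st K G v = Some (out v)
       & correct P (@edge I G) (@input I G) out) ->
  exists2 A : algorithm I O, solves P A c &
    forall (G : network I) (R : realType) (v : node G) i,
      wf_network c G -> instance P (@edge I G) -> isSome (st i G v) ->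
      (termination_time A R v <= ((r #|node G| i)%:R)%:E)%E.
Proof.
move=> st_local st_mono st_total.
pose compat (w : view I) (o : O) := exists (G : network I) (v : node G) t i,
  [/\ wf_network c G, instance P (@edge I G), view_at t v = w,
      r #|node G| i <= t & st i G v = Some o].
(* Classical choice of a compatible output; local computation is unrestricted. *)
pose out (w : view I) :=
  if pselect (exists o, compat w o) is left h then Some (projT1 (cid h)) else None.
pose A := Algorithm (InitView (I := I)) (fun s _ => s) (fun s ms => NextView s ms) out.
have stateE (G : network I) t (v : node G) : state_at A t v = view_at t v.
  by elim: t v => [//|t IH] v /=; rewrite IH; congr NextView; apply: eq_map.
have outP (G : network I) t (v : node G) o : wf_network c G ->
    instance P (@edge I G) -> out (view_at t v) = Some o ->
    exists i, st i G v = Some o.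
  move=> wfG iG; rewrite /out; case: pselect => // h [].
  (* The chosen witness may be another network with the same view; [view_at_time] equates the times
     and locality carries the output back to [G]. *)
  case: (cid h) => /= o' [G' [v' [t' [i [wfG' iG' E rt so]]]]] <-.
  exists i; rewrite -so; apply/esym/st_local; apply: view_at_le rt _.
  by rewrite E (view_at_time E).
have out_some (G : network I) t (v : node G) i : wf_network c G ->
    instance P (@edge I G) -> r #|node G| i <= t -> isSome (st i G v) ->
    isSome (out (view_at t v)).
  move=> wfG iG rt; case so: (st i G v) => [ o|//] _.
  rewrite /out; case: pselect => // -[]; exists o; by exists G, v, t, i.
exists A.
  move=> G wfG iG; have [ o oE oC] := st_total G wfG iG.
  exists o => // v.
  have ex : exists t, has_output A t v.
    exists (r #|node G| K); rewrite /has_output stateE.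
    by apply: out_some (leqnn _) _ => //; rewrite oE.
  exists (ex_minn ex).
    case: ex_minnP => t; rewrite /has_output stateE /=.
    case E: (out _) => [ o'|//] _ _; congr Some.
    have [i si] := outP _ _ _ _ wfG iG E.
    (* The output found and the final one both persist to stage [maxn i K], where they coincide. *)
    have := st_mono G wfG iG v _ _ _ (leq_maxl i K) si.
    have := st_mono G wfG iG v _ _ _ (leq_maxr i K) (oE v).
    by move=> -> [].
  move=> s; case: ex_minnP => t _ tmin st'; apply/negP => /tmin.
  by rewrite leqNgt st'.
move=> G R v i wfG iG si; apply: ereal_inf_lbound.
exists (r #|node G| i) => //=.
by rewrite /has_output stateE; apply: out_some si.
Qed.

Lemma count_port I c (G : network I) (v : node G) (P : pred (node G)) : wf_network c G ->
  count P (port v) = #|[set u | edge v u & P u]|.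
Proof.
case=> wf _ _; rewrite (permP (wf v)) -size_filter cardE.
apply/perm_size/uniq_perm => [||u]; [exact/filter_uniq/enum_uniq|exact: enum_uniq|].
by rewrite mem_filter !mem_enum inE andbC.
Qed.

Lemma mem_port I c (G : network I) (v u : node G) : wf_network c G -> (u \in port v) = edge v u.
Proof. by case=> wf _ _; rewrite (perm_mem (wf v)) mem_enum. Qed.

(** * Levels *)

Section Levels.
Implicit Types G : network node_input.

Definition act G (v : node G) : bool := active (@input _ G) v.

(** Peels the whole active subgraph at once. Peeling never looks beyond a component, so this agrees
    with [remaining] on each of them. *)
Fixpoint survives (i : nat) G (v : node G) : bool :=
  if i is i'.+1 then survives i' v && (2 < count (@survives i' G) (port v))
  else act v.

Definition level_of (k : nat) G (v : node G) : nat :=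
  (find (fun i => ~~ survives i.+1 v) (iota 0 k)).+1.

Arguments level_of : simpl never.

Lemma level_of_gt0 k G (v : node G) : 0 < level_of k v.
Proof. by []. Qed.

Lemma local_act : local 0 act.
Proof. by move=> G G' v v' E; rewrite /act /active (local_input E). Qed.

Lemma local_survives i : local i (survives i).
Proof.
elim: i => [|i IH]; first exact: local_act.
move=> G G' v v' E /=; rewrite (IH _ _ _ _ (view_at_le (leqnSn i) E)).
by have /(congr1 (count id)) := local_ports IH E; rewrite !count_map => ->.
Qed.

Lemma local_level_of k : local k (level_of k).
Proof.
move=> G G' v v' E; congr _.+1; apply: eq_in_find => i.
rewrite mem_iota add0n => /= ik.
by rewrite -/(survives i.+1 v) -/(survives i.+1 v') (local_survives (view_at_le ik E)).
Qed.

Lemma survives_le i j G (v : node G) : i <= j -> survives j v -> survives i v.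
Proof.
elim: j => [|j IH]; first by rewrite leqn0 => /eqP ->.
by rewrite leq_eqVlt => /orP[/eqP ->//|ij] /= /andP[/(IH ij)].
Qed.

Lemma level_of_le k G (v : node G) : level_of k v <= k.+1.
Proof. by rewrite ltnS -[X in _ <= X](size_iota 0) find_size. Qed.

Lemma survives_level k j G (v : node G) : j <= k ->
  survives j v = act v && (j < level_of k v).
Proof.
move=> jk; case: (boolP (act v)) => /= av; last first.
  by apply/negP => /(survives_le (leq0n j)); apply/negP.
rewrite ltnS; set f := find _ _; case: leqP => jf.
  case: j jk jf => [//|j] jk jf.
  by have := before_find 0 jf; rewrite nth_iota // add0n => /negbFE.
apply/negP => /(survives_le jf); apply/negP.
have fk := leq_trans jf jk.
have := @nth_find _ 0 (fun i => ~~ survives i.+1 v) (iota 0 k).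
by rewrite has_find size_iota -/f nth_iota // add0n; apply.
Qed.

Lemma active_componentP G (v0 v u : node G) :
  act v0 -> v \in active_component (@edge _ G) (@input _ G) v0 ->
  act v /\ (edge v u -> act u -> u \in active_component (@edge _ G) (@input _ G) v0).
Proof.
rewrite !inE => av0 c0v; have av : act v.
  case/connectP: c0v => p ep ->; elim: p v0 av0 ep => //= x p IH y _ /andP[/and3P[_ _ ax]].
  exact: IH.
split=> // evu au; apply: connect_trans c0v (connect1 _).
by rewrite evu /= -!/(act _) av au.
Qed.

Lemma remaining_survives c G (v0 v : node G) i : wf_network c G -> act v0 ->
  v \in active_component (@edge _ G) (@input _ G) v0 ->
  (v \in remaining (@edge _ G) (active_component (@edge _ G) (@input _ G) v0) i)
    = survives i v.
Proof.
move=> wf av0; elim: i v => [|i IH] v vS.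
  by have [av _] := active_componentP v av0 vS; rewrite /= vS av.
rewrite /= inE IH // (count_port _ _ wf); congr (_ && (_ < _)).
apply: eq_card => u; rewrite !inE; case: (boolP (edge v u)) => evu; last by rewrite andbF.
rewrite andbT; case: (boolP (act u)) => au.
  by rewrite IH //; have [_] := active_componentP u av0 vS; apply.
apply/idP/idP => [ur|/(survives_le (leq0n _))]; last by rewrite /= (negbTE au).
suff : u \in active_component (@edge _ G) (@input _ G) v0.
  by case/(active_componentP u av0); rewrite (negbTE au).
elim: i ur {IH} => [//|i IH] /=; rewrite inE => /andP[/IH]//.
Qed.

Lemma level_component c k G (v0 v : node G) : wf_network c G -> act v0 ->
  v \in active_component (@edge _ G) (@input _ G) v0 ->
  level (@edge _ G) k (active_component (@edge _ G) (@input _ G) v0) v = level_of k v.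
Proof.
move=> wf av0 vS; congr _.+1; apply: eq_find => i.
by rewrite (remaining_survives _ wf av0 vS).
Qed.

(** The node is removed in the round given by its level, when its active neighbors of at least that
    level are still present. *)
Lemma level_of_upper_degree c k G (v : node G) : wf_network c G -> act v ->
  level_of k v <= k ->
  #|[set u | edge v u & act u && (level_of k v <= level_of k u)]| <= 2.
Proof.
move=> wf av lk; rewrite -(count_port _ _ wf) leqNgt; apply/negP => H.
have : survives (level_of k v) v = false by rewrite (survives_level (k := k)) // ltnn andbF.
case L: (level_of k v) H lk => [//|l] H lk /= /negP; apply.
rewrite (survives_level (k := k)) ?av ?L ?leqnn ?(ltnW lk) //=; apply: leq_trans H _.
rewrite leq_eqVlt; apply/orP; left; apply/eqP; apply: eq_count => u.
by rewrite (survives_level (k := k)) // ltnW.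
Qed.

(** A node of level [l] has more than two remaining neighbors before round [l - 1] and at most two
    after it, so one of them is removed in that round. *)
Lemma level_of_lower_neighbor c k G (v : node G) : wf_network c G -> act v ->
  1 < level_of k v <= k ->
  exists u, [/\ edge v u, act u & level_of k u = (level_of k v).-1].
Proof.
move=> wf av /andP[]; case L: (level_of k v) => [//|[//|j]] _ jk.
have sj1 : survives j.+1 v by rewrite (survives_level (k := k)) ?av ?L //= ltnW.
have /andP[_ big] : survives j v && (2 < count (@survives j G) (port v)) by exact: sj1.
have : ~~ survives j.+2 v.
  by rewrite (survives_level (k := k)) ?L ?ltnn ?andbF.
rewrite [survives j.+2 v]/= -/(survives j.+1 v) sj1 /= -leqNgt => small.
have : ~~ all (fun u => survives j u ==> survives j.+1 u) (port v).
  apply/negP => /allP H; have cle : count (@survives j G) (port v) <= count (@survives j.+1 G) (port v).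
    elim: (port v) H => //= u s IH H; apply: leq_add.
      by have := H u (mem_head _ _); rewrite /=; case: (survives j u) => // /= ->.
    by apply: IH => w ws; apply: H; rewrite inE ws orbT.
  by have := leq_trans (leq_trans big cle) small; rewrite ltnn.
case/allPn => u; rewrite (mem_port _ _ wf) negb_imply => evu /andP[sju].
rewrite -/(survives j.+1 u) => nsu; exists u; have au := survives_le (leq0n j) sju.
split=> //; move: sju nsu.
by rewrite !(survives_level (k := k)) ?au /=; lia.
Qed.

End Levels.

(** * Labels of the active nodes *)

Lemma foldr_minnP (s : seq nat) (a : nat) : a \in s ->
  foldr minn a s \in s /\ forall x, x \in s -> foldr minn a s <= x.
Proof.
move=> as_; have le : forall x, x \in s -> foldr minn a s <= x.
  elim: s {as_} => //= y s IH x; rewrite inE geq_min => /orP[/eqP ->|/IH ->].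
    by rewrite leqnn.
  by rewrite orbT.
split=> //; have : foldr minn a s \in a :: s.
  elim: s {as_ le} => [|y s IH] /=; first by rewrite mem_head.
  move: IH; rewrite !inE /minn; case: ifP => _; first by rewrite eqxx orbT.
  by case/orP => ->; rewrite ?orbT.
by rewrite inE => /orP[/eqP ->|].
Qed.

(** * Coloring or rejecting a component by bounded exploration *)

Section ComponentLabel.
Variables (I : Type) (U : forall G : network I, node G -> bool).
Implicit Types G : network I.

(** The boolean is the parity of a walk; in a bipartite graph it tells on which side of the
    2-coloring the walk ends. *)
Fixpoint reach (t : nat) G (v : node G) : seq (bool * nat) :=
  (false, ident v) ::
  if t is t'.+1 then
    flatten [seq if U u then [seq (~~ x.1, x.2) | x <- reach t' u] else [::] | u <- port v]
  else [::].

(** The node of least identifier is the common reference: its side gets [LabW]. When the size test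
    passes, depth [g] has explored the whole component. *)
Definition comp_label (g : nat) G (v : node G) : label :=
  let s := reach g v in
  if size (undup (map snd s)) <= g then
    if (false, foldr minn (ident v) (map snd s)) \in s then LabW else LabB
  else LabD.

Lemma local_reach r t : local r U -> local (r + t) (reach t).
Proof.
move=> lU; elim: t => [|t IH] G G' v v' E /=.
  by rewrite (local_ident (view_at_le (leq0n _) E)).
rewrite (local_ident (view_at_le (leq0n _) E)); congr (_ :: flatten _).
move: E; rewrite addnS; apply: (@local_ports _ _ _
  (fun G u => if U u then [seq (~~ x.1, x.2) | x <- reach t u] else [::])).
by move=> H H' u u' E; rewrite (IH _ _ _ _ E) (local_le _ lU E) ?leq_addr.
Qed.

Lemma local_comp_label r g : local r U -> local (r + g) (comp_label g).
Proof.
move=> /(local_reach (t := g)) lr G G' v v' E.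
by rewrite /comp_label (lr _ _ _ _ E) (local_ident (view_at_le (leq0n _) E)).
Qed.

Variables (c : nat) (G : network I).
Hypothesis wf : wf_network c G.

Definition component (v : node G) : {set node G} :=
  [set z | connect [rel a b | [&& edge a b, U a & U b]] v z].

Lemma reachP t (v : node G) b n : U v ->
  reflect (exists p, [/\ path [rel a b | [&& edge a b, U a & U b]] v p,
                         size p <= t, odd (size p) = b & ident (last v p) = n])
          ((b, n) \in reach t v).
Proof.
elim: t v b n => [|t IH] v b n Uv /=; rewrite inE.
  rewrite xpair_eqE; apply: (iffP andP) => [[/eqP -> /eqP ->]|]; first by exists [::].
  by case=> -[|? ?] [] //= _ _ <- <-.
apply: (iffP orP) => [[|/flatten_mapP[u]]|].
- by rewrite xpair_eqE => /andP[/eqP -> /eqP ->]; exists [::].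
- rewrite (mem_port _ _ wf) => evu; case: (boolP (U u)) => // Uu.
  case/mapP => -[b' n'] /(IH _ _ _ Uu)[p [ep sp bp lp]] [-> ->].
  exists (u :: p); split=> //=; first by rewrite evu Uv Uu.
  by rewrite bp.
- case=> -[|u p] [/=]; first by move=> _ _ <- <-; left.
  case/andP=> /and3P[evu _ Uu] ep sp <- <-; right.
  apply/flatten_mapP; exists u; first by rewrite (mem_port _ _ wf).
  rewrite Uu; apply/mapP; exists (odd (size p), ident (last u p)) => //.
  by apply/IH => //; exists p.
Qed.

Lemma reach_component t (v : node G) n : U v -> n \in map snd (reach t v) ->
  exists2 z, z \in component v & ident z = n.
Proof.
move=> Uv /mapP[[b n'] /(reachP _ _ _ Uv)[p [ep _ _ lp]] ->].
by exists (last v p) => //; rewrite inE; apply/connectP; exists p.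
Qed.

Lemma component_reach_uniq t (v z : node G) : U v -> z \in component v ->
  exists p, [/\ path [rel a b | [&& edge a b, U a & U b]] v p, uniq (v :: p),
    last v p = z & size p <= t -> ident z \in map snd (reach t v)].
Proof.
move=> Uv; rewrite inE => /connectP[p0 /shortenP[p ep up _] ->].
exists p; split=> // sp; apply/mapP; exists (odd (size p), ident (last v p)) => //.
by apply/reachP => //; exists p.
Qed.

Lemma component_reach t (v z : node G) : U v -> #|component v| <= t ->
  z \in component v -> ident z \in map snd (reach t v).
Proof.
move=> Uv Ct /(component_reach_uniq t Uv)[p [ep up lp]]; apply.
rewrite ltnW // -[(size p).+1]/(size (v :: p)) (leq_trans _ Ct) //.
rewrite -(card_uniqP up); apply/subset_leq_card/fintype.subsetP => x xp.
by rewrite inE; apply: path_connect ep _ xp.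
Qed.

(** A component with more than [g] nodes is either seen entirely or has a node missed by the
    exploration; a simple path to that node starts with [g + 1] distinct nodes that are seen. *)
Lemma size_reach g (v : node G) : U v ->
  (size (undup (map snd (reach g v))) <= g) = (#|component v| <= g).
Proof.
move=> Uv; have [_ inj_id _] := wf; apply/idP/idP => [|Cg]; last first.
  apply: leq_trans Cg; rewrite cardE -[X in _ <= X](size_map (@ident _ G)).
  apply: uniq_leq_size (undup_uniq _) _ => n.
  rewrite mem_undup => /(reach_component Uv)[z zC <-].
  by apply: map_f; rewrite mem_enum.
apply: contraTT; rewrite -!ltnNge => gC.
have id_uniq (s : seq (node G)) : uniq s -> {subset map (@ident _ G) s <= map snd (reach g v)} ->
    size s <= size (undup (map snd (reach g v))).
  move=> us sub; rewrite -(size_map (@ident _ G)); apply: uniq_leq_size.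
    by rewrite map_inj_uniq.
  by move=> n /sub; rewrite mem_undup.
case: (boolP [forall z in component v, ident z \in map snd (reach g v)]) => [/forall_inP H|].
  apply: leq_trans gC _; rewrite cardE; apply: id_uniq (enum_uniq _) _ => n /mapP[z].
  by rewrite mem_enum => zC ->; apply: H.
rewrite negb_forall_in => /exists_inP[z zC zn].
have [p [ep up lp H]] := component_reach_uniq g Uv zC.
have gp : g < size p by rewrite ltnNge; apply: contra zn.
have stg : size (take g p) = g by rewrite size_takel // ltnW.
have -> : g.+1 = size (v :: take g p) by rewrite /= stg.
apply: id_uniq => [|n /mapP[x xp ->]].
  move: up => /= /andP[vp up]; rewrite take_uniq // andbT.
  by apply: contra vp; apply: mem_take.
move: xp (take_path g ep) (leqnn (size (take g p))); rewrite [X in _ <= X]stg.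
case/splitPl => q1 q2 lx; rewrite cat_path size_cat => /andP[eq1 _] sq.
apply/mapP; exists (odd (size q1), ident x) => //.
by apply/reachP => //; exists q1; split; rewrite ?lx //; lia.
Qed.

Lemma component_eq (u v : node G) : symmetric (@edge _ G) -> U u -> U v -> edge u v ->
  component u = component v.
Proof.
move=> esym Uu Uv euv; apply/setP => z; rewrite !inE.
apply/idP/idP; apply: connect_trans; apply: connect1 => /=.
  by rewrite esym euv Uu Uv.
by rewrite euv Uu Uv.
Qed.

Lemma comp_label_D g (v : node G) : U v ->
  (comp_label g v = LabD) <-> (g < #|component v|).
Proof.
move=> Uv; rewrite /comp_label size_reach // ltnNge; case: leqP => //= _.
by split=> //; case: ifP.
Qed.

Lemma comp_label_E g (v : node G) : comp_label g v <> LabE.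
Proof. by rewrite /comp_label; case: ifP => //; case: ifP. Qed.

(* The parity of the length of a walk to the node of minimal identifier is
   determined by a global proper 2-coloring. *)
Lemma comp_label_proper g (u v : node G) : is_tree (@edge _ G) -> U u -> U v ->
  edge u v -> comp_label g u <> LabD -> comp_label g u <> comp_label g v.
Proof.
move=> tG Uu Uv euv nD; have [_ esym _ _ _] := tG.
have [chi chiP] := tree_two_coloring tG.
have CE := component_eq esym Uu Uv euv.
have Cu : #|component u| <= g.
  by rewrite leqNgt; apply/negP => /(comp_label_D g Uu).
have Cv : #|component v| <= g by rewrite -CE.
have sameE : map snd (reach g u) =i map snd (reach g v).
  move=> n; apply/idP/idP => /reach_component[] // z zC <-; apply: component_reach => //.
    by rewrite -CE.
  by rewrite CE.
have um : ident u \in map snd (reach g u).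
  by apply: component_reach => //; rewrite inE connect0.
have vm : ident v \in map snd (reach g v).
  by apply: component_reach => //; rewrite inE connect0.
have [mu1 mu2] := foldr_minnP um; have [mv1 mv2] := foldr_minnP vm.
have mE : foldr minn (ident u) (map snd (reach g u))
        = foldr minn (ident v) (map snd (reach g v)).
  by apply/eqP; rewrite eqn_leq mu2 ?mv2 // ?sameE // -sameE.
have parity w z b : U w -> (b, ident z) \in reach g w -> chi z = chi w (+) b.
  move=> Uw /(reachP _ _ _ Uw)[p [ep _ <- lp]].
  have [_ inj_id _] := wf; rewrite -(inj_id _ _ lp) {lp}.
  elim: p w ep {Uw} => [|x p IH] w /=; first by rewrite addbF.
  by case/andP=> /and3P[/chiP cx _ _] /IH ->; rewrite cx addbN addNb.
have [z zC zm] := reach_component Uu mu1.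
have evenE w : U w -> ident z \in map snd (reach g w) ->
    ((false, ident z) \in reach g w) = (chi z == chi w).
  move=> Uw /mapP[[b n] bn /= zn]; rewrite zn in zm *; apply/idP/eqP.
    by rewrite -zn => /(parity _ _ _ Uw); rewrite addbF.
  have := bn; rewrite -{1}zn => /(parity _ _ _ Uw) -> .
  by case: b bn => // _; rewrite addbT; case: (chi w).
rewrite /comp_label !size_reach // Cu Cv -mE -zm !evenE ?zm //; last first.
  by rewrite mE.
by rewrite (chiP _ _ euv); case: (chi z) (chi u) => [] [].
Qed.

End ComponentLabel.

Lemma card_le_mul (V : finType) (e : rel V) (A B : {set V}) (m : nat) :
  (forall b, b \in B -> exists2 a, a \in A & e a b) ->
  (forall a, a \in A -> #|[set b in B | e a b]| <= m) -> #|B| <= m * #|A|.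
Proof.
move=> BA Am; apply: (@leq_trans (\sum_(a in A) #|[set b in B | e a b]|)).
  under eq_bigr => a _ do rewrite -sum1dep_card.
  rewrite (exchange_big_dep (mem B)) /=; last by move=> ? ? _ /andP[].
  rewrite -sum1_card; apply: leq_sum => b bB; have [a aA eab] := BA b bB.
  by rewrite (bigD1 a) //= aA bB eab.
by rewrite mulnC -sum_nat_const; apply: leq_sum.
Qed.

(** * Labels known after each stage *)

Section StageLabels.
Variables (k : nat) (g : nat -> nat).
Implicit Types G : network node_input.

(** An unknown label counts as not W, B or E. This is harmless because a component is explored only
    when all lower levels are decided. *)
Definition is_wbe (o : option label) : bool :=
  match o with Some LabW | Some LabB | Some LabE => true | _ => false end.

(* The labels of the nodes of level at most [j] that are known once the
   components of level at most [i] have been explored. *)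
Fixpoint lam (i j : nat) G (v : node G) : option label :=
  if j is j'.+1 then
    if act v && (level_of k v == j) then
      if has (fun u => is_wbe (lam i j' u)) (port v) then Some LabE
      else if j <= i then
        Some (comp_label (fun G (u : node G) => [&& act u, level_of k u == j &
                ~~ has (fun w => is_wbe (lam i j' w)) (port u)]) (g j) v)
      else None
    else lam i j' v
  else None.

Arguments lam : simpl never.

(** The index is one less than the level: [lam i j] knows only the levels below [j.+1]. *)
Definition free (i j : nat) G (v : node G) : bool :=
  [&& act v, level_of k v == j.+1 & ~~ has (fun w => is_wbe (lam i j w)) (port v)].

Definition stage_label (i : nat) G (v : node G) : option label :=
  if level_of k v == k.+1 then Some LabE else lam i k v.

(** Radius [k] to know the levels, one step per level to look at lower neighbors, and the depth of
    every exploration carried out. *)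
Definition lam_radius (i j : nat) : nat := k + j + \sum_(l < j | l < i) g l.+1.

Lemma lamS i j G (v : node G) : lam i j.+1 v =
  if act v && (level_of k v == j.+1) then
    if has (fun u => is_wbe (lam i j u)) (port v) then Some LabE
    else if j < i then Some (comp_label (free i j) (g j.+1) v) else None
  else lam i j v.
Proof. by []. Qed.

Lemma local_lam i j : local (lam_radius i j) (lam i j).
Proof.
rewrite /lam_radius; elim: j => [|j IH] // G G' v v'.
set r := k + j + _ in IH.
have -> : k + j.+1 + \sum_(l < j.+1 | l < i) g l.+1 = r.+1 + (if j < i then g j.+1 else 0).
  by rewrite /r big_mkcond big_ord_recr /= -big_mkcond; case: ifP => _; rewrite addnS !addSn addnA.
move=> E.
have hasE H H' (u : node H) (u' : node H') : view_at r.+1 u = view_at r.+1 u' ->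
    has (fun w => is_wbe (lam i j w)) (port u) = has (fun w => is_wbe (lam i j w)) (port u').
  move/(local_ports IH)/(congr1 (has is_wbe)); by rewrite !has_map.
have kr : k <= r.+1 by rewrite /r; lia.
have fl : local r.+1 (free i j).
  move=> H H' u u' F; rewrite /free (local_act (view_at_le (leq0n _) F)).
  by rewrite (local_level_of (view_at_le kr F)) (hasE _ _ _ _ F).
have Er := view_at_le (leq_addr _ _) E.
rewrite !lamS (local_act (view_at_le (leq0n _) E)) (local_level_of (view_at_le kr Er)).
rewrite (hasE _ _ _ _ Er) (IH _ _ _ _ (view_at_le (leqnSn _) Er)).
by case: (j < i) E => [/(local_comp_label fl) ->|].
Qed.

Lemma local_stage_label i : local (lam_radius i k) (stage_label i).
Proof.
move=> G G' v v' E; rewrite /stage_label (local_lam E).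
by rewrite (local_level_of (view_at_le _ E)) // /lam_radius; lia.
Qed.

Lemma lam_level i j G (v : node G) :
  lam i j v = if act v && (level_of k v <= j) then lam i (level_of k v) v else None.
Proof.
elim: j => [|j IH]; first by rewrite leqn0 andbF.
rewrite {1}lamS; case: (boolP (act v)) IH => av /= IH; last exact: IH.
case: (ltngtP (level_of k v) j.+1) => [lt|gt|L]; first by rewrite IH ifT.
by rewrite IH ifF //; apply/negP; lia.
by rewrite L lamS av L eqxx.
Qed.

Lemma is_wbe_lam i j G (v : node G) : j <= k ->
  is_wbe (lam i j v) = [&& act v, level_of k v <= j & is_wbe (lam i k v)].
Proof.
move=> jk; rewrite (lam_level i j) (lam_level i k); case: (act v) => //=.
by case: leqP => //= lj; rewrite (leq_trans lj jk).
Qed.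

Lemma lam_stable i i' j G (v : node G) : j <= i -> i <= i' -> lam i' j v = lam i j v.
Proof.
move=> ji ii'; elim: j ji G v => [|j IH] ji G v //.
rewrite !lamS ji (leq_trans ji ii') (IH (ltnW ji)).
have hE H (u : node H) : has (fun w => is_wbe (lam i' j w)) (port u)
                       = has (fun w => is_wbe (lam i j w)) (port u).
  by apply: eq_has => w; rewrite (IH (ltnW ji)).
(* [comp_label] takes [free] as a function on all networks, so the pointwise equality is lifted by
   extensionality. *)
suff -> : free i' j = free i j by rewrite hE.
apply: functional_extensionality_dep => H; apply: functional_extensionality_dep => u.
by rewrite /free hE.
Qed.

(** Up to level [i] nothing changes. Beyond it the only known label is E, caused by a lower neighbor
    whose own label persists by induction. *)
Lemma lam_mono i i' j G (v : node G) l : i <= i' ->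
  lam i j v = Some l -> lam i' j v = Some l.
Proof.
move=> ii'; elim: j v l => [|j IH] v l //.
case: (leqP j.+1 i) => [ji|ij]; first by rewrite (@lam_stable i i').
rewrite !lamS (ltnNge j i) -ltnS ij /=; case: ifP => _; last exact: IH.
case: ifP => // /hasP[u uv wu] [<-]; case: ifP => // /negP[].
apply/hasP; exists u => //; move: wu; case E: (lam i j u) => [l'|//].
by rewrite (IH _ _ E).
Qed.

Lemma stage_label_mono i i' G (v : node G) l : i <= i' ->
  stage_label i v = Some l -> stage_label i' v = Some l.
Proof. by move=> ii'; rewrite /stage_label; case: ifP => // _; apply: lam_mono. Qed.

Variables (c : nat) (G : network node_input).
Hypotheses (wf : wf_network c G) (tG : is_tree (@edge _ G)).
Implicit Types v u : node G.

Lemma has_lower i v : level_of k v <= k ->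
  has (fun u => is_wbe (lam i (level_of k v).-1 u)) (port v) =
  [exists u, [&& edge v u, act u, level_of k u < level_of k v & is_wbe (stage_label i u)]].
Proof.
move=> lk; have lk1 : (level_of k v).-1 <= k by lia.
apply/hasP/existsP => [[u]|[u /and4P[evu au lu wu]]].
  rewrite (mem_port _ _ wf) is_wbe_lam // => evu /and3P[au lu wu].
  exists u; rewrite evu au /stage_label.
  have -> : level_of k u == k.+1 = false by lia.
  by rewrite wu andbT; have := level_of_gt0 k v; lia.
exists u; rewrite ?(mem_port _ _ wf) // is_wbe_lam // au.
move: wu; rewrite /stage_label; have -> : level_of k u == k.+1 = false by lia.
by move=> ->; rewrite andbT; lia.
Qed.

(** Folds the recursion over levels into one equation for [stage_label] itself. *)
Lemma stage_labelE i v : act v -> level_of k v <= k -> stage_label i v =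
  if [exists u, [&& edge v u, act u, level_of k u < level_of k v & is_wbe (stage_label i u)]]
  then Some LabE
  else if level_of k v <= i
  then Some (comp_label (free i (level_of k v).-1) (g (level_of k v)) v) else None.
Proof.
move=> av lk; rewrite -has_lower // /stage_label lam_level av lk.
have -> : level_of k v == k.+1 = false by lia.
case L: (level_of k v) => [|l]; first by have := level_of_gt0 k v; rewrite L.
by rewrite lamS av L eqxx.
Qed.

Lemma freeE i v : act v -> level_of k v <= k -> free i (level_of k v).-1 v =
  ~~ [exists u, [&& edge v u, act u, level_of k u < level_of k v & is_wbe (stage_label i u)]].
Proof.
move=> av lk; rewrite -has_lower // /free av prednK ?eqxx //.
Qed.

End StageLabels.

(** * Correctness of the labels and decrease of the undecided nodes *)

Section StageLabelsCorrect.
Variables (k : nat) (g : nat -> nat) (c : nat) (G : network node_input).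
Hypotheses (wf : wf_network c G) (tG : is_tree (@edge _ G)).
Implicit Types v u : node G.

Let edge_sym : symmetric (@edge _ G). Proof. by case: tG. Qed.

Lemma free_stable i j : j <= i -> free k g i j = free k g j j.
Proof.
move=> ji; apply: functional_extensionality_dep => H.
apply: functional_extensionality_dep => v; rewrite /free.
congr [&& _, _ & ~~ _]; apply: eq_has => w; by rewrite (lam_stable _ _ _ (leqnn j) ji).
Qed.

Lemma stage_label_total v : act v -> isSome (stage_label k g k v).
Proof.
move=> av; have := level_of_le k v; rewrite leq_eqVlt => /orP[L|].
  by rewrite /stage_label L.
by rewrite ltnS => lk; rewrite (stage_labelE _ wf) // lk; case: ifP.
Qed.

Definition free_set (j : nat) : {set node G} := [set v | free k g j j v].

Lemma free_componentE j v :
  component (free k g j j) v =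
  [set z | connect [rel a b | [&& edge a b, a \in free_set j & b \in free_set j]] v z].
Proof.
apply/setP => z; rewrite !inE; apply: eq_connect => a b /=.
by rewrite !inE.
Qed.

(** A free node of level [j + 2] has a neighbor of level [j + 1] not labeled W, B or E, hence
    labeled D: it is free, in a component with more than [g j.+1] nodes. Now [component_boundary]
    applies. *)
Lemma card_free_set_step j : j.+2 <= k ->
  (g j.+1).+1 * #|free_set j.+1| <= 2 * #|free_set j|.
Proof.
move=> jk; apply: (component_boundary edge_sym).
- rewrite disjoint_subset; apply/fintype.subsetP => v; rewrite !inE.
  by case/and3P => _ /eqP L _; rewrite /free L; apply/negP => /and3P[_ /eqP]; lia.
- move=> v; rewrite inE => /and3P[av /eqP L _].
  apply: leq_trans (level_of_upper_degree (k := k) wf av _); last by rewrite L; lia.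
  apply/subset_leq_card/fintype.subsetP => u; rewrite !inE L => /andP[].
  by case/orP => /and3P[-> /eqP -> _] ->; rewrite ?leqnn ?leqnSn.
- move=> v; rewrite inE => fv; have /and3P[av /eqP L nl] := fv.
  have [|u [evu au Lu]] := @level_of_lower_neighbor c k G v wf av.
    by rewrite L jk.
  rewrite L /= in Lu; exists u.
  have Luk : level_of k u <= k by rewrite Lu; lia.
  have nl' : ~~ is_wbe (lam k g j.+1 j.+1 u).
    by apply: contra nl => wu; apply/hasP; exists u; rewrite // (mem_port _ _ wf).
  rewrite is_wbe_lam ?au ?Lu ?leqnn //= in nl'; last by lia.
  have := stage_labelE g wf j.+1 au Luk; have := freeE g wf j.+1 au Luk.
  rewrite Lu /= (free_stable (leqnSn j)) leqnn.
  rewrite {2}/stage_label Lu ifF; last by lia.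
  case: ifP => [_ _ E|_ fu E]; first by rewrite E in nl'.
  split=> //; first by rewrite inE.
  rewrite -free_componentE; apply/(comp_label_D wf _ fu).
  by rewrite E in nl'; case E' : (comp_label _ _ _) nl'.
Qed.

(** The cardinality hypothesis excludes D on level [k]: a component of free nodes of that level lies
    in [free_set k.-1] and so stays within the threshold. *)
Lemma stage_label_correct (lab : node G -> label) :
  0 < k -> #|free_set k.-1| <= g k ->
  (forall v, act v -> stage_label k g k v = Some (lab v)) ->
  forall v0, act v0 ->
    hierarchical_coloring (@edge _ G) k (active_component (@edge _ G) (@input _ G) v0) lab.
Proof.
move=> k0 small labE v0 av0 L0 v vS; rewrite {}/L0.
have LE u : u \in active_component (@edge _ G) (@input _ G) v0 ->
    level (@edge _ G) k (active_component (@edge _ G) (@input _ G) v0) u = level_of k u.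
  exact: level_component wf av0.
have [av _] := active_componentP v av0 vS.
have inS u : edge v u -> act u -> u \in active_component (@edge _ G) (@input _ G) v0.
  by move=> evu au; have [_] := active_componentP u av0 vS; apply.
have actS u : u \in active_component (@edge _ G) (@input _ G) v0 -> act u.
  by move=> uS; have [] := active_componentP u av0 uS.
rewrite LE //; have lab_eq u : act u -> level_of k u <= k ->
    lab u = (if [exists w, [&& edge u w, act w, level_of k w < level_of k u
                               & is_wbe (Some (lab w))]]
             then LabE else comp_label (free k g (level_of k u).-1 (level_of k u).-1)
                                       (g (level_of k u)) u).
  move=> au lu; have := stage_labelE g wf k au lu; rewrite labE // lu.
  rewrite free_stable; last by lia.
  rewrite (eq_existsb (P2 := fun w => [&& edge u w, act w, level_of k w < level_of k u
                               & is_wbe (Some (lab w))])); first by case: ifP => _ [].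
  by move=> w; case: (boolP (act w)) => aw; rewrite ?andbF // labE.
have freeP u : act u -> level_of k u <= k ->
    free k g (level_of k u).-1 (level_of k u).-1 u = ~~ [exists w, [&& edge u w,
      act w, level_of k w < level_of k u & is_wbe (Some (lab w))]].
  move=> au lu; have := freeE g wf k au lu.
  rewrite free_stable; last by lia.
  move=> ->; congr (~~ _); apply: eq_existsb => w.
  by case: (boolP (act w)) => aw; rewrite ?andbF // labE.
split.
- move=> L; rewrite lab_eq ?L //; case: ifP => [/existsP[u /and4P[_ _]]|_].
    by have := level_of_gt0 k u; lia.
  exact: comp_label_E.
- by move=> L; have := labE v av; rewrite /stage_label L eqxx => -[].
- case/andP=> L1 lk; rewrite lab_eq //; split.
    case: ifP => [/existsP[u /and4P[evu au lu wu]] _|_ /comp_label_E //].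
    exists u; split=> //; [exact: inS|by rewrite LE // inS|].
    by case: (lab u) wu => // _; [constructor 1|constructor 2|constructor 3].
  case=> u [uS evu]; rewrite LE // => lu wu; rewrite ifT //.
  apply/existsP; exists u; rewrite evu lu actS //.
  by case: wu => ->.
- case/andP=> _ lk u uS evu; rewrite LE // => lu; have au := actS u uS.
  (* A neighbor of the same level is labeled E, or it is free and shares the component of [v]. D is
     given to a whole component; otherwise W and B alternate in it. *)
  have key : lab v <> LabE -> lab v <> LabD -> lab u <> lab v /\ lab u <> LabD.
    rewrite !lab_eq ?lu //; have := freeP v av lk; have := freeP u au.
    rewrite lu => /(_ lk).
    case: ifP => // _; case: ifP => // _ fu fv nE nD.
    + by split=> // /esym.
    + have CE := component_eq edge_sym fv fu evu.
      split; first by move=> /esym; apply: (comp_label_proper wf tG fv fu evu nD).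
      by move=> /(comp_label_D wf _ fu); rewrite -CE => /(comp_label_D wf _ fv).
  by split=> vE; move: key; rewrite vE => -[].
- move=> L; rewrite lab_eq ?L //; case: ifP => // ex; have := freeP v av.
  rewrite L leqnn ex => /(_ isT) fv /(comp_label_D wf _ fv); apply/negP; rewrite -leqNgt.
  apply: leq_trans small; apply/subset_leq_card/fintype.subsetP => z.
  rewrite free_componentE inE => /connectP[p ep ->].
  have vF : v \in free_set k.-1 by rewrite inE.
  elim: p v vF ep {fv vS av inS L ex} => //= x p IH y _ /andP[/and3P[_ _ xF]].
  exact: IH.
Qed.

Definition undecided (i : nat) : {set node G} :=
  [set v | act v && ~~ isSome (stage_label k g i v)].

Lemma undecided_level i v : v \in undecided i -> i < level_of k v <= k.
Proof.
rewrite inE => /andP[av E]; have := level_of_le k v.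
rewrite leq_eqVlt => /orP[L|]; first by rewrite /stage_label L in E.
rewrite ltnS => lk; rewrite lk andbT ltnNge; apply/negP => li.
by move: E; rewrite (stage_labelE _ wf) // li; case: ifP.
Qed.

(** An undecided node above level [i + 1] has an undecided neighbor one level below: W, B or E there
    would force E, and D requires a later stage. Each node has at most two neighbors above it, hence
    a factor 2 per level. Undecided nodes of level [i + 1] are free. *)
Lemma card_undecided_level i m : i + m.+1 <= k ->
  #|[set v in undecided i | level_of k v == i + m.+1]| <= 2 ^ m * #|free_set i|.
Proof.
elim: m => [|m IH] imk.
  rewrite mul1n; apply/subset_leq_card/fintype.subsetP => v; rewrite !inE.
  case/andP=> /andP[av E] /eqP L; have lk : level_of k v <= k by rewrite L.
  have := freeE g wf i av lk; rewrite L addn1 /= => ->.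
  by move: E; rewrite (stage_labelE _ wf) // L addn1; case: ifP.
rewrite expnS -mulnA; apply: leq_trans (leq_mul (leqnn 2) (IH _)); last by lia.
apply: (@card_le_mul _ (@edge _ G)) => [v|u].
  rewrite !inE => /andP[/andP[av E] /eqP L].
  have lk : level_of k v <= k by rewrite L.
  have [|u [evu au Lu]] := @level_of_lower_neighbor c k G v wf av; first by rewrite L; lia.
  rewrite L addnS /= in Lu; exists u; last by rewrite edge_sym.
  rewrite !inE au Lu eqxx andbT /=.
  have luk : level_of k u <= k by rewrite Lu; lia.
  rewrite (stage_labelE _ wf) // Lu (_ : (i + m.+1 <= i) = false); last by lia.
  case: ifP => // ex; move: E; rewrite (stage_labelE _ wf) // ifT //.
  apply/existsP; exists u; rewrite evu au Lu L (stage_labelE _ wf) // Lu ex /= andbT.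
  lia.
rewrite !inE => /andP[/andP[au _] /eqP L].
have lk : level_of k u <= k by rewrite L; lia.
apply: leq_trans (level_of_upper_degree wf au lk).
apply/subset_leq_card/fintype.subsetP => v; rewrite !inE L.
by case/andP=> /andP[/andP[-> _] /eqP ->] ->; rewrite /=; lia.
Qed.

Lemma card_undecided i : #|undecided i| <= k.+1 * 2 ^ k * #|free_set i|.
Proof.
pose f v : 'I_k.+1 := inord (level_of k v).
rewrite -sum1_card (partition_big f xpredT) //= -mulnA -[X in _ <= X * _](card_ord k.+1).
rewrite -sum_nat_const; apply: leq_sum => l _; rewrite sum1dep_card.
apply: (@leq_trans #|[set v in undecided i | level_of k v == l]|).
  apply/subset_leq_card/fintype.subsetP => v; rewrite !inE => /andP[vZ /eqP <-].
  have /undecided_level/andP[_ lk] : v \in undecided i by rewrite inE.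
  by rewrite vZ inordK /=.
case: (leqP l i) => [li|il].
  rewrite (_ : finset _ = finset.set0) ?cards0 //; apply/setP => v.
  rewrite !inE; apply/negP => /andP[vZ /eqP L].
  have /undecided_level : v \in undecided i by rewrite inE.
  by rewrite L; lia.
have [m lE] : exists m, l = i + m.+1 :> nat by exists (l - i.+1); lia.
rewrite lE; apply: leq_trans (card_undecided_level _) _; first by have := ltn_ord l; lia.
by rewrite leq_mul2r leq_exp2l // orbC; have := ltn_ord l; lia.
Qed.

End StageLabelsCorrect.

(** * Outputs of the weight nodes *)

Section WeightRule.
Variables (d R L : nat).
Implicit Types G : network node_input.

Definition contact G (v : node G) : bool := ~~ act v && has (@act G) (port v).

Fixpoint weight_walks (t : nat) G (v : node G) : seq (seq (node G)) :=
  [:: v] ::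
  if t is t'.+1 then
    [seq v :: p | p <- flatten [seq weight_walks t' u | u <- port v & ~~ act u]]
  else [::].

Definition connectors G (v : node G) : seq nat :=
  if contact v then
    flatten [seq map (@ident _ G) p | p <- weight_walks L v &
               [&& uniq (map (@ident _ G) p), 1 < size p & contact (last v p)]]
  else [::].

(** Every node of a connecting path is within distance [L] of the end that announces the path, so
    gathering to depth [L] suffices. *)
Definition connects G (v : node G) : bool := ident v \in gather connectors L v.

Definition copy_root G (v : node G) : bool := contact v && ~~ connects v.

(* The identifier [p] is that of the parent of [v], if any. *)
Definition children G (v : node G) (p : option nat) : seq (node G) :=
  [seq u <- port v | ~~ act u && (Some (ident u) != p)].

Fixpoint subtree (t : nat) G (v : node G) (p : option nat) : seq (node G) :=
  v :: if t is t'.+1 then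
    flatten [seq subtree t' u (Some (ident v)) | u <- children v p]
  else [::].

(** The order is decreasing, so that [drop d] discards the [d] largest subtrees. *)
Definition by_size (t : nat) G (v : node G) (p : option nat) : seq (node G) :=
  sort (fun a b => size (subtree t b (Some (ident v))) <= size (subtree t a (Some (ident v))))
    (children v p).

Fixpoint region (t : nat) G (v : node G) (p : option nat) : seq (node G) :=
  v :: if t is t'.+1 then
    flatten [seq region t' u (Some (ident v)) | u <- drop d (by_size t' v p)]
  else [::].

(** The default [v] never matters, since sources are taken at contacts only. *)
Definition source G (v : node G) : node G := head v [seq u <- port v | act u].

Variable lab : forall G, node G -> option label.

(** A label that is still unknown is announced as [None], which makes the nodes of the region wait
    instead of declining. *)
Definition entries G (v : node G) : seq (nat * option label) :=
  if copy_root v then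
    [seq (ident u, lab (source v)) | u <- region R v None]
  else [::].

Definition rule_output G (v : node G) : option node_output :=
  if act v then omap Color (lab v)
  else if connects v then Some Connect
  else if [seq x.2 | x <- gather entries R v & x.1 == ident v] is o :: _
  then omap Copy o else Some Decline.

(** Nodes of two networks live in different types. They are compared through triples of test, key
    and value, on which filtering and sorting commute with [map]. *)
Lemma eq_selection (A B : Type) (sA : seq A) (sB : seq B) (Y : Type)
    (PA : pred A) (PB : pred B) (mA : A -> nat) (mB : B -> nat) (hA : A -> Y) (hB : B -> Y) n :
  [seq (PA x, mA x, hA x) | x <- sA] = [seq (PB x, mB x, hB x) | x <- sB] ->
  [seq hA x | x <- drop n (sort (fun a b => mA b <= mA a) (seq.filter PA sA))] =
  [seq hB x | x <- drop n (sort (fun a b => mB b <= mB a) (seq.filter PB sB))].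
Proof.
pose S (s : seq (bool * nat * Y)) := [seq x.2 | x <- drop n
  (sort (fun a b => b.1.2 <= a.1.2) [seq x <- s | x.1.1])].
move/(congr1 S); rewrite /S !filter_map !sort_map -!map_drop -!map_comp.
by [].
Qed.

Lemma eq_filtered (A B Y : Type) (sA : seq A) (sB : seq B)
    (PA : pred A) (PB : pred B) (hA : A -> Y) (hB : B -> Y) :
  [seq (PA x, hA x) | x <- sA] = [seq (PB x, hB x) | x <- sB] ->
  [seq hA x | x <- sA & PA x] = [seq hB x | x <- sB & PB x].
Proof.
pose S (s : seq (bool * Y)) := [seq x.2 | x <- s & x.1].
by move/(congr1 S); rewrite /S !filter_map -!map_comp.
Qed.

Lemma local_contact : local 1 contact.
Proof.
move=> G G' v v' E; rewrite /contact (local_act (view_at_le (leq0n _) E)).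
by have /(congr1 (has id)) := local_ports local_act E; rewrite !has_map => ->.
Qed.

Lemma local_weight_walks t : local t.+1
  (fun G v => [seq [seq (ident u, contact u) | u <- p] | p <- @weight_walks t G v]).
Proof.
elim: t => [|t IH] G G' v v' E.
  by rewrite /= (local_ident (view_at_le (leq0n _) E)) (local_contact E).
rewrite /= (local_ident (view_at_le (leq0n _) E)) (local_contact (view_at_le _ E)) //.
congr (_ :: _); rewrite -!map_comp /comp /=.
rewrite (local_ident (view_at_le (leq0n _) E)) (local_contact (view_at_le _ E)) //.
pose h G (u : node G) := [seq [seq (ident u, contact u) | u <- p] | p <- @weight_walks t G u].
have : [seq (~~ act u, h G u) | u <- port v] = [seq (~~ act u, h G' u) | u <- port v'].
  apply: (@local_ports _ _ _ (fun G u => (~~ act u, h G u)) _ _ _ _ _ E).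
  by move=> H H' u u' F; rewrite (local_act (view_at_le (leq0n _) F)) /h (IH _ _ _ _ F).
move/eq_filtered => hE.
have flatE H (w : node H) (s : seq (node H)) (x : nat * bool) :
    [seq x :: [seq (ident u, contact u) | u <- p] | p <- flatten [seq weight_walks t u | u <- s]]
    = [seq x :: q | q <- flatten [seq h H u | u <- s]].
  by elim: s => //= u s IHs; rewrite !map_cat IHs /h -map_comp.
by rewrite !flatE ?hE.
Qed.

Lemma local_connectors : local L.+1 connectors.
Proof.
move=> G G' v v' E; rewrite /connectors (local_contact (view_at_le _ E)) //.
case: ifP => // _; have := local_weight_walks E.
pose S (s : seq (seq (nat * bool))) := flatten [seq map fst p | p <- s &
  [&& uniq (map fst p), 1 < size p & (last (ident v, contact v) p).2]].
have SE H (w : node H) : ident w = ident v -> contact w = contact v ->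
  S [seq [seq (ident u, contact u) | u <- p] | p <- @weight_walks L H w] =
  flatten [seq map (@ident _ H) p | p <- weight_walks L w &
               [&& uniq (map (@ident _ H) p), 1 < size p & contact (last w p)]].
  move=> iw cw; rewrite /S filter_map -map_comp; congr flatten.
  rewrite (seq.eq_filter (a2 := fun p => [&& uniq (map (@ident _ H) p), 1 < size p & contact (last w p)])).
    by apply: eq_map => p /=; rewrite -map_comp.
  by move=> p /=; rewrite -map_comp size_map -iw -cw (last_map (fun u => (ident u, contact u))).
move/(congr1 S); rewrite !SE //.
  by rewrite (local_ident (view_at_le (leq0n _) E)).
by rewrite (local_contact (view_at_le _ E)).
Qed.

Lemma local_connects : local (L.+1 + L) connects.
Proof.
move=> G G' v v' E; rewrite /connects (local_ident (view_at_le (leq0n _) E)).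
by rewrite (local_gather local_connectors E).
Qed.

Lemma local_copy_root : local (L.+1 + L) copy_root.
Proof.
move=> G G' v v' E; rewrite /copy_root (local_connects E).
by rewrite (local_contact (view_at_le _ E)).
Qed.

Lemma local_subtree t : local t (fun G v p => map (@ident _ G) (@subtree t G v p)).
Proof.
elim: t => [|t IH] G G' v v' E; apply/funext => p.
  by rewrite /= (local_ident E).
rewrite /= (local_ident (view_at_le (leq0n _) E)); congr (_ :: _).
rewrite !map_flatten -!map_comp; congr flatten.
apply: eq_filtered; move: E.
apply: (@local_ports _ _ _ (fun G u => (~~ act u && (Some (ident u) != p),
  ([eta map (@ident _ G)] \o (fun u => subtree t u (Some (ident v')))) u))).
move=> H H' u u' F; rewrite (local_act (view_at_le (leq0n _) F)) /=.
by rewrite (local_ident (view_at_le (leq0n _) F)) (congr1 (@^~ _) (IH _ _ _ _ F)).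
Qed.

Lemma local_region t : local t (fun G v p => map (@ident _ G) (@region t G v p)).
Proof.
elim: t => [|t IH] G G' v v' E; apply/funext => p.
  by rewrite /= (local_ident E).
rewrite /= (local_ident (view_at_le (leq0n _) E)); congr (_ :: _).
rewrite !map_flatten -!map_comp /by_size (local_ident (view_at_le (leq0n _) E)); congr flatten.
apply: eq_selection; move: E.
apply: (@local_ports _ _ _ (fun G u => (~~ act u && (Some (ident u) != p),
  size (subtree t u (Some (ident v'))),
  ([eta map (@ident _ G)] \o (fun u => region t u (Some (ident v')))) u))).
move=> H H' u u' F; rewrite (local_act (view_at_le (leq0n _) F)) /=.
rewrite (local_ident (view_at_le (leq0n _) F)) (congr1 (@^~ _) (IH _ _ _ _ F)).
by rewrite -(size_map (@ident _ H)) (congr1 (@^~ _) (local_subtree F)) size_map.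
Qed.

Variable r : nat.
Hypothesis lab_local : local r lab.

Lemma local_entries : local (r.+1 + (L.+1 + L) + R) entries.
Proof.
move=> G G' v v' E; rewrite /entries (local_copy_root (view_at_le _ E)); last by lia.
have sourceE : lab (source v) = lab (source v').
  have headE (H : network node_input) (w : node H) s : lab (head w s) = head (lab w) (map (@lab H) s).
    by case: s.
  rewrite /source !headE (lab_local (view_at_le _ E)); last by lia.
  congr head; apply: eq_filtered.
  have Er : view_at r.+1 v = view_at r.+1 v' by apply: view_at_le E; lia.
  apply: (@local_ports _ _ _ (fun G u => (act u, lab u)) _ _ _ _ _ Er).
  by move=> H H' u u' F; rewrite (local_act (view_at_le (leq0n _) F)) (lab_local F).
have ER : view_at R v = view_at R v' by apply: view_at_le E; lia.
case: ifP => // _; have := congr1 (@^~ None) (local_region ER).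
move/(congr1 (map (fun i => (i, lab (source v))))); rewrite -!map_comp /comp => ->.
by rewrite sourceE.
Qed.

(** One step to a source and [r] more for its label, [L.+1 + L] to recognize the roots, [R] to
    explore a region and [R] to spread the label in it. *)
Lemma local_rule_output : local (r.+1 + (L.+1 + L) + R + R) rule_output.
Proof.
move=> G G' v v' E; rewrite /rule_output (local_act (view_at_le (leq0n _) E)).
rewrite (lab_local (view_at_le _ E)); last by lia.
rewrite (local_connects (view_at_le _ E)); last by lia.
by rewrite (local_gather local_entries E) (local_ident (view_at_le (leq0n _) E)).
Qed.

End WeightRule.

HB.instance Definition _ := gen_eqMixin label.

(** * Correctness of the rule for weight nodes *)

Section WeightRuleCorrect.
Variables (d R L c : nat) (G : network node_input).
Hypotheses (wf : wf_network c G) (tG : is_tree (@edge _ G)) (RL : 2 * R < L).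
Implicit Types v u w : node G.

Let edge_sym : symmetric (@edge _ G). Proof. by case: tG. Qed.
Let ident_inj : injective (@ident _ G). Proof. by case: wf. Qed.

Definition weight_edge : rel (node G) := [rel a b | [&& edge a b, ~~ act a & ~~ act b]].

Lemma weight_edge_sym : symmetric weight_edge.
Proof. by move=> a b; rewrite /weight_edge /= edge_sym [~~ act a && _]andbC. Qed.

Lemma weight_path_edge v q : path weight_edge v q -> path (@edge _ G) v q.
Proof. by apply: sub_path => a b /and3P[]. Qed.

Lemma weight_path_rev v q : path weight_edge v q ->
  exists q', [/\ path weight_edge (last v q) q', last (last v q) q' = v & size q' = size q].
Proof.
move=> ep; exists (rev (belast v q)); split; last by rewrite size_rev size_belast.
  by rewrite rev_path; apply: sub_path ep => a b; rewrite weight_edge_sym.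
by case: q {ep} => //= u q; rewrite rev_cons last_rcons.
Qed.

Lemma weight_path_weight v q u : ~~ act v -> path weight_edge v q -> u \in v :: q -> ~~ act u.
Proof.
elim: q v => [|w q IH] v av /=; first by rewrite inE => _ /eqP ->.
by case/andP=> /and3P[_ _ aw] ep; rewrite inE => /orP[/eqP -> //|]; apply: IH.
Qed.

Lemma weight_walksP t v p : ~~ act v ->
  reflect (exists q, [/\ p = v :: q, path weight_edge v q & size q <= t])
          (p \in weight_walks t v).
Proof.
elim: t v p => [|t IH] v p av /=; rewrite inE.
  by apply: (iffP eqP) => [->|[[|? ?] [-> //]]]; exists [::].
apply: (iffP orP) => [[/eqP ->|/mapP[p' /flatten_mapP[u]]]|[q [->]]].
- by exists [::].
- rewrite mem_filter (mem_port _ _ wf) => /andP[au evu] /(IH _ _ au)[q [-> ep sq]] ->.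
  by exists (u :: q); split=> //=; rewrite /weight_edge /= evu av au.
- case: q => [_ _|u q /= /andP[/and3P[evu _ au] ep] sq]; [by left|right].
  apply/mapP; exists (u :: q) => //; apply/flatten_mapP; exists u.
    by rewrite mem_filter au (mem_port _ _ wf).
  by apply/IH => //; exists q.
Qed.

Definition connector_path v q : bool :=
  [&& contact v, path weight_edge v q, size q <= L, uniq (v :: q), 0 < size q
    & contact (last v q)].

Lemma connectsP v : reflect (exists a q, connector_path a q /\ v \in a :: q) (connects L v).
Proof.
apply: (iffP idP) => [/gather_mem[a]|[a [q [cp vq]]]].
  rewrite /connectors; case: ifP => // ca /flatten_mapP[p].
  have aa : ~~ act a by case/andP: ca.
  rewrite mem_filter => /andP[/and3P[up sp lp] /(weight_walksP _ _ aa)[q [pq ep sq]]].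
  case/mapP => u up' /ident_inj ->; exists a, q; rewrite -pq; split=> //.
  move: up sp lp; rewrite pq map_inj_uniq // => up sp lp.
  by rewrite /= ltnS in sp; rewrite /connector_path ca ep sq up lp sp.
have /and5P[ca ep sq up /andP[q0 lq]] := cp; have aa : ~~ act a by case/andP: ca.
have [q1 [q2 [def_q lv]]] : exists q1 q2, q = q1 ++ q2 /\ last a q1 = v.
  by case/splitPl: vq => q1 q2; exists q1, q2.
have := ep; rewrite def_q cat_path => /andP[eq1 _].
have [q' [eq' lq' sq']] := weight_path_rev eq1; rewrite lv in eq' lq'.
apply: (@mem_gather _ _ _ _ _ _ a q').
- by case: wf.
- exact: weight_path_edge eq'.
- exact: lq'.
- by rewrite sq'; apply: leq_trans sq; rewrite def_q size_cat leq_addr.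
- rewrite /connectors ca; apply/flatten_mapP; exists (a :: q); last exact: map_f.
  rewrite mem_filter map_inj_uniq // up lq ltnS q0 /=.
  by apply/weight_walksP => //; exists q.
Qed.

(** On either side of [v] the connecting path continues with a connecting node or, at an end, with
    an active neighbor, because its ends are contacts. *)
Lemma connects_degree v : ~~ act v -> connects L v ->
  1 < #|[set u | edge v u && (act u || connects L u)]|.
Proof.
move=> av /connectsP[a [q [cp vq]]]; have /and5P[ca ep sq up /andP[q0 lq]] := cp.
have conn u : u \in a :: q -> connects L u by move=> uq; apply/connectsP; exists a, q.
have contactE u : contact u -> exists2 w, edge u w & act w.
  by case/andP=> _ /hasP[w]; rewrite (mem_port _ _ wf); exists w.
have wt u : u \in a :: q -> ~~ act u.
  by apply: weight_path_weight => //; case/andP: ca.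
have sq1 : 1 < size (a :: q) by rewrite ltnS.
have srt : sorted weight_edge (a :: q) by [].
have hd : contact (head v (a :: q)) by [].
have lst : contact (last v (a :: q)) by [].
move: (a :: q) vq up conn wt sq1 srt hd lst => {a q cp ca ep q0 lq sq} s vs.
case/splitPr: vs => p1 p2 up conn wt sq1 srt hd lst.
(* The last clause records where [y] comes from. With the analogous clause for [z] it yields
   [y <> z], as the path is simple and has no active node. *)
have [y [evy cy py]] : exists y, [/\ edge v y, act y || connects L y
                                   & if p1 is [::] then act y : bool else y \in p1].
  case/lastP: p1 up conn wt sq1 srt hd lst => [|p1 y] up conn wt sq1 srt hd lst.
    by have [y evy ay] := contactE _ hd; exists y; rewrite evy ay.
  have yp : y \in rcons p1 y by rewrite mem_rcons mem_head.
  exists y; split; last by case: (rcons p1 y) yp.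
    have := last_rcons v p1 y; case: (rcons p1 y) yp srt => //= x p3 _.
    by rewrite cat_path /= => /and3P[_ /and3P[]]; rewrite edge_sym => + _ _ _ <-.
  by rewrite conn ?orbT // mem_cat yp.
have [z [evz cz pz]] : exists z, [/\ edge v z, act z || connects L z
                                   & if p2 is [::] then act z : bool else z \in p2].
  case: p2 up conn wt sq1 srt hd lst {y evy cy py} => [|z p2] up conn wt sq1 srt hd lst.
    rewrite last_cat in lst.
    by have [y evy ay] := contactE _ lst; exists y; rewrite evy ay.
  exists z; split; last by rewrite mem_head.
    have /= := srt; case: (p1) => [|x p3] /=; first by case/andP=> /and3P[].
    by rewrite cat_path /= => /and4P[_ _ /and3P[]].
  by rewrite conn ?orbT // mem_cat !inE eqxx !orbT.
apply/card_gt1P; exists y, z; rewrite !inE evy evz cy cz; split=> //; apply/eqP => yz; subst z.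
case: p1 p2 up wt sq1 py pz {conn srt hd lst} => [|x p1] [|x' p2] up wt sq1 py pz //.
- have := wt y; rewrite py mem_cat inE pz !orbT => /(_ isT)//.
- by have := wt y; rewrite pz mem_cat py => /(_ isT).
- move: up; rewrite cat_uniq => /and3P[_ /hasPn /(_ y)].
  by rewrite inE pz orbT py => /(_ isT).
Qed.

(** A second contact within weight distance [L] would put the root on a connecting path. *)
Lemma copy_root_far v w q : copy_root L v -> contact w -> path weight_edge v q ->
  last v q = w -> size q <= L -> v = w.
Proof.
case/andP=> cv nc cw ep lq sq; apply/eqP/negPn/negP => vw.
move/negP: nc; apply; apply/connectsP.
move: lq; case/shortenP: ep => q' ep' uq' sub lq'; exists v, q'; split; last exact: mem_head.
have sq' : size q' <= size q by apply: uniq_leq_size => //; case/andP: uq'.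
rewrite /connector_path cv ep' uq' lq' cw (leq_trans sq' sq) andbT /=.
by case: (q') lq' => //= vw'; rewrite vw' eqxx in vw.
Qed.

Lemma subtree_path t v p u : ~~ act v -> u \in subtree t v p ->
  exists q, [/\ path weight_edge v q, last v q = u & size q <= t].
Proof.
elim: t v p => [|t IH] v p av; rewrite /= inE.
  by move/eqP ->; exists [::].
case/orP => [/eqP ->|/flatten_mapP[w]]; first by exists [::].
rewrite mem_filter (mem_port _ _ wf) => /andP[/andP[aw _] evw] /(IH _ _ aw)[q [ep lq sq]].
by exists (w :: q); split=> //=; rewrite /weight_edge /= evw av aw.
Qed.

Lemma mem_by_size t v p u :
  (u \in by_size t v p) = [&& edge v u, ~~ act u & Some (ident u) != p].
Proof. by rewrite mem_sort mem_filter (mem_port _ _ wf) andbC. Qed.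

Lemma region_subtree t v p : {subset region d t v p <= subtree t v p}.
Proof.
elim: t v p => [|t IH] v p u //=; rewrite !inE => /orP[->//|/flatten_mapP[w]].
move=> /mem_drop; rewrite mem_by_size => /and3P[evw aw wp] /IH uw.
apply/orP; right; apply/flatten_mapP; exists w => //.
by rewrite mem_filter aw wp (mem_port _ _ wf).
Qed.

Lemma copy_root_contact v : copy_root L v -> contact v.
Proof. by case/andP. Qed.

Lemma contact_weight v : contact v -> ~~ act v.
Proof. by case/andP. Qed.

(** Equal or adjacent nodes of two subtrees of depth [R] join the roots by a weight walk of length
    at most [2 * R + 1 <= L]. *)
Lemma subtree_root_eq v v' u u' : copy_root L v -> copy_root L v' ->
  u \in subtree R v None -> u' \in subtree R v' None -> u = u' \/ edge u u' -> v = v'.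
Proof.
move=> rv rv' uv uv' uu'.
have av := contact_weight (copy_root_contact rv).
have av' := contact_weight (copy_root_contact rv').
have [q [ep lq sq]] := subtree_path av uv.
have [q' [ep' lq' sq']] := subtree_path av' uv'.
have [q2 [ep2 lq2 sq2]] := weight_path_rev ep'.
rewrite lq' in ep2 lq2.
have au : ~~ act u by apply: (weight_path_weight av ep); rewrite -lq mem_last.
have au' : ~~ act u' by apply: (weight_path_weight av' ep'); rewrite -lq' mem_last.
have sqq : size q + size q2 < L.
  by apply: leq_ltn_trans RL; rewrite sq2 mul2n -addnn leq_add.
case: uu' => [E|euu'].
  apply: (copy_root_far rv (copy_root_contact rv') (q := q ++ q2)).
  - by rewrite cat_path ep lq E.
  - by rewrite last_cat lq E.
  - by rewrite size_cat ltnW.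
apply: (copy_root_far rv (copy_root_contact rv') (q := q ++ u' :: q2)).
- by rewrite cat_path ep lq /= ep2 andbT /weight_edge /= euu' au au'.
- by rewrite last_cat /=.
- by rewrite size_cat addnS.
Qed.

Lemma uniq_flatten_disjoint (T S : eqType) (f : T -> seq S) (s : seq T) : uniq s ->
  (forall a, a \in s -> uniq (f a)) ->
  (forall a b x, a \in s -> b \in s -> x \in f a -> x \in f b -> a = b) ->
  uniq (flatten (map f s)).
Proof.
elim: s => //= a s IH /andP[as_ us] uf df; rewrite cat_uniq uf ?mem_head //=.
apply/andP; split; last first.
  apply: IH => // [b bs|b b' x bs bs']; first by apply: uf; rewrite inE bs orbT.
  by apply: df; rewrite inE ?bs ?bs' orbT.
apply/hasPn => x /flatten_mapP[b bs xb]; apply/negP => xa.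
have ab : a = b by apply: (df a b x) => //; rewrite inE ?eqxx ?bs ?orbT.
by rewrite ab bs in as_.
Qed.

(** In the tree rooted at [v] each step to a child increases the distance by one and is undone by
    [up]. A node therefore determines its ancestor at every depth, and the subtrees of siblings are
    disjoint. *)
Lemma subtree_uniq t v : uniq (subtree t v None).
Proof.
clear RL; have [dist [dv dpar d1 dlow]] := tree_layers v tG.
have [up upP] : exists up : node G -> node G, forall x, x != v ->
    edge x (up x) /\ dist x = (dist (up x)).+1.
  exists (fun x => odflt v [pick y | edge x y && (dist x == (dist y).+1)]) => x xv.
  case: pickP => [y /andP[exy /eqP]//|H].
  by have [y exy dy] := dpar x xv; have := H y; rewrite exy dy eqxx.
have childP w p x : (w = v /\ p = None) \/
      (exists2 y, p = Some (ident y) & edge w y /\ dist w = (dist y).+1) ->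
    edge w x -> Some (ident x) != p -> dist x = (dist w).+1 /\ up x = w.
  move=> wp ewx xp; have dx : dist x = (dist w).+1.
    case: (d1 _ _ ewx) => // dx; case: wp => [[wv _]|[y py [ewy dy]]].
      by rewrite wv dv in dx.
    have xy : x = y by apply: (dlow w) => //; lia.
    by rewrite py xy eqxx in xp.
  split=> //; have xv : x != v by apply/eqP => xv; rewrite xv dv in dx.
  have [exu du] := upP x xv; apply: (dlow x) => //; try lia.
  by rewrite edge_sym.
(* The disjunction says that [p] designates the parent of [w] in the tree rooted at [v]. *)
suff key : forall t w p, (w = v /\ p = None) \/
      (exists2 y, p = Some (ident y) & edge w y /\ dist w = (dist y).+1) ->
    uniq (subtree t w p) /\ forall x, x \in subtree t w p ->
      dist w <= dist x /\ iter (dist x - dist w) up x = w.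
  by have [] := key t v None _; first by left.
elim=> [|{}t IH] w p wp.
  by split=> // x; rewrite /= inE => /eqP ->; rewrite subnn.
have step x : x \in children w p -> [/\ dist x = (dist w).+1, up x = w
    & uniq (subtree t x (Some (ident w))) /\ forall y, y \in subtree t x (Some (ident w)) ->
      dist x <= dist y /\ iter (dist y - dist x) up y = x].
  rewrite mem_filter (mem_port _ _ wf) => /andP[/andP[_ xp] ewx].
  have [dx ux] := childP _ _ _ wp ewx xp; split=> //; apply: IH; right.
  by exists w => //; split; rewrite 1?edge_sym.
split.
  rewrite /=; apply/andP; split.
    apply/flatten_mapP => -[x /step[dx _ [_ H]] /H[]]; lia.
  apply: uniq_flatten_disjoint => [|x /step[_ _ []]//|a b x].
    apply: filter_uniq; have [wfp _ _] := wf; by rewrite (perm_uniq (wfp w)) enum_uniq.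
  case/step=> da _ [_ Ha]; case/step=> db _ [_ Hb] /Ha[_ <-] /Hb[_ <-].
  by rewrite da db.
move=> x; rewrite /= inE => /orP[/eqP ->|/flatten_mapP[y /step[dy uy [_ H]] /H[le it]]].
  by rewrite subnn.
split; first by lia.
have -> : dist x - dist w = (dist x - dist y).+1 by lia.
by rewrite iterS it.
Qed.

Lemma subtree_card t v : size (subtree t v None) <= #|node G|.
Proof. by rewrite -(card_uniqP (subtree_uniq t v)) max_card. Qed.

Lemma source_active v : contact v -> edge v (source v) /\ act (source v).
Proof.
case/andP=> _; rewrite has_filter /source; case E: (seq.filter _ _) => [//|u s] _ /=.
have : u \in [seq w <- port v | act w] by rewrite E mem_head.
by rewrite mem_filter (mem_port _ _ wf) => /andP[].
Qed.

Lemma size_subtreeS t v p : size (subtree t.+1 v p) =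
  (\sum_(u <- by_size t v p) size (subtree t u (Some (ident v)))).+1.
Proof.
rewrite /= size_flatten /shape -map_comp sumnE big_map; congr _.+1.
by apply: perm_big; rewrite perm_sym perm_sort.
Qed.

Lemma size_regionS t v p : size (region d t.+1 v p) =
  (\sum_(u <- drop d (by_size t v p)) size (region d t u (Some (ident v)))).+1.
Proof. by rewrite /= size_flatten /shape -map_comp sumnE big_map. Qed.

Lemma by_size_sorted t v p :
  sorted (fun a b => size (subtree t b (Some (ident v))) <= size (subtree t a (Some (ident v))))
    (by_size t v p).
Proof. by apply: sort_sorted => a b; apply: leq_total. Qed.

(** As [0 < d], the largest child subtree is dropped, and it is at least as large as that of [u]. *)
Lemma subtree_halves t v p u : 0 < d -> u \in drop d (by_size t v p) ->
  2 * size (subtree t u (Some (ident v))) < size (subtree t.+1 v p).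
Proof.
clear RL; rewrite size_subtreeS ltnS; have := by_size_sorted t v p.
case: (by_size t v p) => [//|b s] /=; case: d => [//|d'] /= ps _ /mem_drop us.
have tr : transitive (fun a b : node G => size (subtree t b (Some (ident v))) <=
                                 size (subtree t a (Some (ident v)))).
  by move=> x y z /= xy yz; exact (leq_trans yz xy).
have /allP/(_ u us) := order_path_min tr ps.
rewrite big_cons (big_rem u us) /=; lia.
Qed.

(** [D] holds the [d] largest children of [u]. The size bound keeps the recursion from being cut
    off: both sides halve at each step, and at [t = 0] the bound is absurd. The clause on [p]
    exempts the parent of the top node. *)
Lemma region_declines t v p : 0 < d -> ~~ act v -> size (subtree t v p) < 2 ^ t ->
  forall u, u \in region d t v p -> exists2 D : seq (node G), size D <= d &
    forall w, edge u w -> [|| act w, (u == v) && (Some (ident w) == p),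
                             w \in region d t v p | w \in D].
Proof.
clear RL; move=> d0; elim: t v p => [|t IH] v p av; first by [].
move=> small u.
have regE : region d t.+1 v p =
  v :: flatten [seq region d t u (Some (ident v)) | u <- drop d (by_size t v p)] by [].
rewrite {1}regE inE => /orP[/eqP ->|/flatten_mapP[x xd]].
  exists (take d (by_size t v p)); first by rewrite size_take; case: ltnP.
  move=> w evw; rewrite eqxx /=; case: (boolP (act w)) => //= aw.
  case: (boolP (_ == p)) => //= wp; rewrite inE.
  have : w \in take d (by_size t v p) ++ drop d (by_size t v p).
    by rewrite cat_take_drop mem_by_size evw aw wp.
  rewrite mem_cat => /orP[->|wd]; first by rewrite orbT.
  apply/orP; left; apply/orP; right; apply/flatten_mapP; exists w => //.
  by case: (t) => [|?] /=; rewrite mem_head.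
move=> ux; have half := subtree_halves d0 xd.
have := mem_drop xd; rewrite mem_by_size => /and3P[evx ax _].
have [|D sD DP] := IH x (Some (ident v)) ax _ u ux.
  by move: half small; rewrite expnS; lia.
exists D => // w /DP /or4P[->|/andP[_ /eqP [/ident_inj ->]]|wr|->] //.
- by rewrite regE mem_head !orbT.
- apply/or4P; apply: Or43; rewrite regE inE; apply/orP; right.
  by apply/flatten_mapP; exists x.
- by rewrite !orbT.
Qed.

Section Output.
Variable lab : forall H : network node_input, node H -> option label.

(** By [subtree_root_eq] a single root announces a label to [u], so the first entry found is the
    right one. *)
Lemma rule_output_copy v u : copy_root L v -> u \in region d R v None ->
  ~~ connects L u -> rule_output d R L lab u = omap Copy (lab (source v)).
Proof.
move=> rv ur ncu; have us := region_subtree ur.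
have av := contact_weight (copy_root_contact rv).
have [q [ep lq sq]] := subtree_path av us.
have [q' [ep' lq' sq']] := weight_path_rev ep; rewrite lq in ep' lq'.
rewrite /rule_output ifN; last by apply: (weight_path_weight av ep); rewrite -lq mem_last.
rewrite (negbTE ncu); set s := [seq _ | _ <- _ & _].
have sP o : o \in s -> o = lab (source v).
  case/mapP=> -[i o']; rewrite mem_filter /= => /andP[/eqP ->] /gather_mem[v'].
  rewrite /entries; case: ifP => // rv' /mapP[u' ur' [/ident_inj uu' ->]] ->.
  have us' := region_subtree ur'.
  by rewrite (subtree_root_eq rv rv' us us' (or_introl uu')).
have s0 : lab (source v) \in s.
  apply/mapP; exists (ident u, lab (source v)) => //; rewrite mem_filter eqxx /=.
  apply: (@mem_gather _ _ _ _ _ _ v q').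
  - by case: wf.
  - exact: weight_path_edge.
  - by [].
  - by rewrite sq'.
  - by rewrite /entries rv; apply/mapP; exists u.
by case: s s0 sP => // o s _ sP; rewrite (sP o (mem_head _ _)).
Qed.

Lemma rule_output_decline u : ~~ act u -> ~~ connects L u ->
  (forall v, copy_root L v -> u \notin region d R v None) ->
  rule_output d R L lab u = Some Decline.
Proof.
move=> au ncu nr; rewrite /rule_output ifN // ifN //.
rewrite (eq_in_filter (a2 := pred0)) ?filter_pred0 // => -[i o] /gather_mem[v].
rewrite /entries; case: ifP => // /nr /negP uv /mapP[u' u'v [-> _]] /=.
by apply/negP => /eqP /ident_inj uu'; rewrite uu' in u'v.
Qed.

Lemma rule_correct k (out : node G -> node_output) :
  #|node G| < 2 ^ R -> 0 < d ->
  (forall v, act v -> isSome (lab v)) ->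
  (forall v, rule_output d R L lab v = Some (out v)) ->
  (forall v0, act v0 -> hierarchical_coloring (@edge _ G) k
     (active_component (@edge _ G) (@input _ G) v0) (color_of \o out)) ->
  weighted_correct (@edge _ G) (@input _ G) d k out.
Proof.
move=> n2R d0 labT outE hier.
have root_of u : ~~ act u -> ~~ connects L u -> is_decline (out u) = false ->
    exists2 v, copy_root L v & u \in region d R v None.
  move=> au ncu nd; have [//|H] := pselect (exists2 v, copy_root L v & u \in region d R v None).
  have E : Some (out u) = Some Decline.
    rewrite -outE; apply: rule_output_decline => // v rv.
    by apply/negP => uv; apply: H; exists v.
  by case: E nd => ->.
have outC u : ~~ act u -> connects L u -> out u = Connect.
  move=> au cu; have := outE u; rewrite /rule_output (negbTE au) cu => -[<-//].
have outA u : act u -> exists l, out u = Color l.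
  move=> au; have := outE u; rewrite /rule_output au.
  by case: (lab u) => // l [<-]; exists l.
have outR u v : ~~ act u -> ~~ connects L u -> copy_root L v -> u \in region d R v None ->
    exists l, out u = Copy l /\ out (source v) = Color l.
  move=> au ncu rv ur; have := outE u; rewrite (rule_output_copy rv ur ncu).
  have [_ asrc] := source_active (copy_root_contact rv).
  have := outE (source v); rewrite {1}/rule_output asrc.
  by case: (lab _) => // l [<-] [<-]; exists l.
have outNC u : ~~ act u -> is_connect (out u) -> connects L u.
  move=> au; apply: contraTT => ncu; case: (boolP (is_decline (out u))) => [|nd].
    by case: (out u).
  have [v rv ur] := root_of u au ncu (negbTE nd).
  by have [l [-> _]] := outR u v au ncu rv ur.
(* Every copied label is traced back to a root and its source; the last two conditions of the
   problem then reduce to [region_declines] and [subtree_root_eq]. *)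
have outCopy u l : out u = Copy l -> exists v, [/\ ~~ act u, ~~ connects L u, copy_root L v,
    u \in region d R v None & out (source v) = Color l].
  move=> uE; have au : ~~ act u by apply/negP => /outA[m]; rewrite uE.
  have ncu : ~~ connects L u by apply/negP => /(outC u au); rewrite uE.
  have [|v rv ur] := root_of u au ncu; first by rewrite uE.
  exists v; split=> //; have [m [um sm]] := outR u v au ncu rv ur.
  by move: um; rewrite uE => -[->].
split.
  move=> v; change (is_color (out v) = act v).
  case: (boolP (act v)) => [/outA[l ->]//|av].
  case E: (out v) => [l| | |] //; have := outE v; rewrite /rule_output (negbTE av) E.
  by case: ifP => // _; case: [seq _ | _ <- _ & _] => [//|[m|] _].
split=> //.
- move=> v av [u evu au].
  have cv : contact v.
    by rewrite /contact; apply/andP; split=> //; apply/hasP; exists u; rewrite ?(mem_port _ _ wf).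
  case: (boolP (connects L v)) => [/outC ->//|ncv].
  have rv : copy_root L v by rewrite /copy_root cv.
  have [|l [-> _]] := outR v v av ncv rv; last by rewrite orbT.
  by case: (R) => [|?] /=; rewrite mem_head.
- move=> v av /(outNC v av) /(connects_degree av) /leq_trans; apply.
  apply/subset_leq_card/fintype.subsetP => u; rewrite !inE => /andP[-> /= /orP[au|cu]].
    by apply/orP; left.
  case: (boolP (act u)) => au; first by apply/orP; left.
  by rewrite outC ?orbT.
- move=> v; case vE : (out v) => [| | |l] // _.
  have [r [av _ rr vr _]] := outCopy v l vE.
  have ar := contact_weight (copy_root_contact rr).
  have small : size (subtree R r None) < 2 ^ R by apply: leq_ltn_trans (subtree_card R r) n2R.
  have [D sD DP] := region_declines d0 ar small vr.
  apply: leq_trans sD; apply: leq_trans (card_size D).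
  apply/subset_leq_card/fintype.subsetP => w; rewrite inE => /andP[/DP].
  case/or4P => [/outA[m ->]|/andP[_ //]|wr|//] //.
  have aw : ~~ act w.
    have [q [ep lq _]] := subtree_path ar (region_subtree wr).
    by apply: (weight_path_weight ar ep); rewrite -lq mem_last.
  case: (boolP (connects L w)) => [/(outC w aw) -> //|ncw].
  by have [m [-> _]] := outR w r aw ncw rr wr.
(* A copying contact is its own root, and adjacent copying nodes have the same root. *)
- split=> [v l av vE [u evu au]|u v l m au av euv uE vE].
    have [r [_ ncv rr vr <-]] := outCopy v l vE.
    have cv : contact v.
      by rewrite /contact; apply/andP; split=> //; apply/hasP; exists u; rewrite ?(mem_port _ _ wf).
    have rv : copy_root L v by rewrite /copy_root cv.
    have vv : v \in subtree R v None by case: (R) => [|?] /=; rewrite mem_head.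
    have rE := subtree_root_eq rr rv (region_subtree vr) vv (or_introl erefl).
    by rewrite rE; have [esv asv] := source_active cv; exists (source v); split.
  have [r [_ _ rr ur sl]] := outCopy u l uE; have [r' [_ _ rr' vr' sm]] := outCopy v m vE.
  move: sl sm; have -> := subtree_root_eq rr rr' (region_subtree ur) (region_subtree vr')
    (or_intror euv).
  by move=> -> [].
Qed.

End Output.

End WeightRuleCorrect.

(** * Counting the weight nodes that wait *)

Section WeightCount.
Variables (d R L c : nat) (G : network node_input).
Hypotheses (wf : wf_network c G) (tG : is_tree (@edge _ G)) (RL : 2 * R < L).
Implicit Types v u : node G.

Lemma rule_outputP (lab : forall H, node H -> option label) v : ~~ act v -> ~~ connects L v ->
  (exists r, [/\ copy_root L r, v \in region d R r None
               & rule_output d R L lab v = omap Copy (lab G (source r))])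
  \/ rule_output d R L lab v = Some Decline.
Proof.
move=> av ncv.
have [[r rr vr]|H] := pselect (exists2 r, copy_root L r & v \in region d R r None).
  by left; exists r; rewrite (rule_output_copy wf tG RL _ rr vr ncv).
right; apply: (rule_output_decline wf) => // r rr.
by apply/negP => vr; apply: H; exists r.
Qed.

(** Which nodes connect, copy or decline does not depend on the labels; only the copied label
    does. *)
Lemma rule_output_mono (lab lab' : forall H, node H -> option label) :
  (forall v l, lab G v = Some l -> lab' G v = Some l) ->
  forall v o, rule_output d R L lab v = Some o -> rule_output d R L lab' v = Some o.
Proof.
move=> mono v o; case: (boolP (act v)) => [av|av].
  by rewrite /rule_output av; case E: (lab G v) => //; rewrite (mono _ _ E).
case: (boolP (connects L v)) => [cv|ncv]; first by rewrite /rule_output (negbTE av) cv.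
have [[r [rr vr ->]]|E] := rule_outputP lab av ncv.
  rewrite (rule_output_copy wf tG RL _ rr vr ncv).
  by case E: (lab G _) => //; rewrite (mono _ _ E).
rewrite E => -[<-]; have [[r [rr vr _]]|//] := rule_outputP lab' av ncv.
by move: E; rewrite (rule_output_copy wf tG RL _ rr vr ncv); case: (lab G _).
Qed.

(** A weight node waits only inside the region of a root whose source is undecided, since connecting
    and declining need no label. *)
Lemma card_unfinished (lab : forall H, node H -> option label) :
  #|[set v : node G | ~~ isSome (rule_output d R L lab v)]| <=
  #|[set v : node G | act v && ~~ isSome (lab G v)]| +
  \sum_(r : node G | copy_root L r && ~~ isSome (lab G (source r))) size (region d R r None).
Proof.
set Z := [set v | act v && _]; set X := [set v | _].
rewrite -[#|X|](cardsID Z); apply: leq_add.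
  exact/subset_leq_card/subsetIr.
apply: (@leq_trans (\sum_(r : node G | copy_root L r && ~~ isSome (lab G (source r)))
   \sum_(v in X :\: Z | v \in region d R r None) 1)); last first.
  apply: leq_sum => r _; rewrite sum1dep_card; apply: leq_trans (card_size _).
  by apply/subset_leq_card/fintype.subsetP => v; rewrite inE => /andP[].
rewrite (exchange_big_dep (mem (X :\: Z))) /=; last by move=> ? ? _ /andP[].
rewrite -sum1_card; apply: leq_sum => v vX; rewrite vX /=.
move: vX; rewrite !inE => /andP[vZ vX].
have [av ncv] : ~~ act v /\ ~~ connects L v.
  move: vX vZ; rewrite /rule_output; case: (act v) => /=; first by case: (lab G v).
  by case: (connects L v).
case: (rule_outputP lab av ncv) vX => [[r [rr vr ->]]|->] //.
case E: (lab G (source r)) => // _; rewrite (bigD1 r) //=.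
by rewrite rr E vr.
Qed.

(** The subtrees seen by different roots are disjoint by [subtree_root_eq]. *)
Lemma sum_subtrees :
  \sum_(r : node G | copy_root L r) size (subtree R r None) <= #|node G|.
Proof.
have : uniq (flatten [seq subtree R r None | r <- enum [set r : node G | copy_root L r]]).
  apply: uniq_flatten_disjoint; first exact: enum_uniq.
    by move=> r _; exact: (subtree_uniq wf tG R r).
  move=> r r' u; rewrite !mem_enum !inE => rr rr' ur ur'.
  exact: (subtree_root_eq wf tG RL rr rr' ur ur' (or_introl erefl)).
move/card_uniqP; rewrite size_flatten /shape -map_comp sumnE big_map big_enum /=.
rewrite (eq_bigl (fun r => copy_root L r)); last by move=> r; rewrite inE.
by move=> <-; rewrite max_card.
Qed.

Variable Delta : nat.
Hypothesis deg : max_degree_le (@edge _ G) Delta.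

Lemma card_roots (Z : {set node G}) :
  #|[set r | copy_root L r && (source r \in Z)]| <= Delta * #|Z|.
Proof.
apply: (@card_le_mul _ (@edge _ G)) => [r|u _].
  rewrite inE => /andP[/copy_root_contact /(source_active wf)[er _] rZ].
  by exists (source r) => //; have [_ es _ _ _] := tG; rewrite es.
apply: leq_trans (deg u); apply/subset_leq_card/fintype.subsetP => r.
by rewrite !inE => /andP[].
Qed.

Lemma size_port v : size (port v) <= Delta.
Proof.
have [wfp _ _] := wf; rewrite (perm_size (wfp v)) -cardE.
apply: leq_trans (deg v); apply/subset_leq_card/fintype.subsetP => u.
by rewrite inE.
Qed.

(** One neighbor is never a child: an active one for a contact, the parent otherwise. *)
Lemma size_by_size t v p : contact v \/ (exists2 u, p = Some (ident u) & edge v u) ->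
  size (by_size t v p) < Delta.
Proof.
move=> H; rewrite size_sort; apply: leq_trans (size_port v).
rewrite size_filter ltn_neqAle count_size andbT -all_count; apply/allPn.
case: H => [/andP[_ /hasP[u up au]]|[u -> evu]]; exists u => //.
- by rewrite au.
- by rewrite (mem_port _ _ wf).
- by rewrite eqxx andbF.
Qed.

End WeightCount.

(** Each remaining term is at most each of the [d] dropped ones, so what remains is at most the
    fraction [a / (a + d)] of the total. *)
Lemma sorted_drop_sum (T : eqType) (f : T -> nat) (s : seq T) (d a : nat) :
  sorted (fun x y => f y <= f x) s -> size s <= a + d ->
  (a + d) * \sum_(x <- drop d s) f x <= a * \sum_(x <- s) f x.
Proof.
move=> srt sz; have tr : transitive (fun x y => f y <= f x).
  by move=> y x z /= xy yz; apply: leq_trans yz xy.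
move: srt; rewrite (sorted_pairwise tr) -{1}(cat_take_drop d s) pairwise_cat.
move=> /and3P[/allrelP rel _ _].
rewrite -[in X in _ <= a * X](cat_take_drop d s) big_cat /= mulnDl mulnDr addnC leq_add2r.
have sa : size (drop d s) <= a by rewrite size_drop; lia.
apply: (@leq_trans (size (drop d s) * \sum_(y <- take d s) f y)); last first.
  by rewrite leq_mul2r sa orbT.
case: (leqP d (size s)) => ds; last by rewrite (drop_oversize (ltnW ds)) big_nil muln0.
have {1}-> : d = size (take d s) by rewrite size_takel.
rewrite big_distrr -[X in _ <= X * _]sum1_size big_distrl /= big_seq_cond.
rewrite [X in _ <= X]big_seq_cond; apply: leq_sum => x /andP[xd _]; rewrite mul1n.
rewrite -sum1_size big_distrl /= big_seq_cond [X in _ <= X]big_seq_cond.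
by apply: leq_sum => y /andP[yt _]; rewrite mul1n; apply: rel.
Qed.

Local Open Scope ring_scope.

(** * Size of a copying region *)

(** The tangent at [mu] of a concave power, obtained from Young's inequality for [y]^ x[and]mu
    [^ (1 - x)] with exponents [x^-1] and [(1 - x)^-1]. *)
Lemma powR_le_tangent (R : realType) (x mu y : R) : 0 < x < 1 -> 0 < mu -> 0 <= y ->
  y `^ x <= (1 - x) * mu `^ x + x * mu `^ (x - 1) * y.
Proof.
case/andP=> x0 x1 mu0 y0; have x'0 : 0 < 1 - x by rewrite subr_gt0.
have mu1 : 0 < mu `^ (x - 1) by apply: powR_gt0.
have := @conjugate_powR R (y `^ x) (mu `^ (1 - x)) x^-1 (1 - x)^-1
  (powR_ge0 _ _) (powR_ge0 _ _).
rewrite !invr_gt0 x0 x'0 !invrK addrC subrK => /(_ isT isT erefl).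
rewrite -!powRrM !mulfV ?gt_eqF // !powRr1 ?(ltW mu0) // => H.
rewrite -(ler_pM2l (powR_gt0 (1 - x) mu0)) mulrC; apply: le_trans H _.
have ab : mu `^ (1 - x) * mu `^ x = mu.
  by rewrite -powRD ?(gt_eqF mu0) ?implybT // subrK powRr1 // ltW.
have ac : mu `^ (1 - x) * mu `^ (x - 1) = 1.
  rewrite -powRD ?(gt_eqF mu0) ?implybT // (_ : 1 - x + (x - 1) = 0) ?powRr0 //.
  by ring.
rewrite (_ : mu `^ (1 - x) * _ = (1 - x) * (mu `^ (1 - x) * mu `^ x)
  + x * y * (mu `^ (1 - x) * mu `^ (x - 1))); last by ring.
by rewrite ab ac mulr1 addrC mulrC [y * x]mulrC.
Qed.

(** Jensen's inequality, by summing tangents. [M] may exceed the number of terms because the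
    constant term of the tangent is positive. *)
Lemma sum_powR_le (R : realType) (T : Type) (s : seq T) (F : T -> R) (x mu M : R) :
  0 < x < 1 -> 0 < mu -> (forall i, 0 <= F i) -> (size s)%:R <= M ->
  \sum_(i <- s) F i <= M * mu -> \sum_(i <- s) F i `^ x <= M * mu `^ x.
Proof.
move=> x01 mu0 F0 sM FM; have /andP[x0 x1] := x01.
apply: (@le_trans _ _ (\sum_(i <- s) ((1 - x) * mu `^ x + x * mu `^ (x - 1) * F i))).
  by apply: ler_sum => i _; apply: powR_le_tangent.
rewrite big_split /= big_const_seq count_predT iter_addr addr0 -mulr_sumr.
have mu1 : 0 < mu `^ (x - 1) by apply: powR_gt0.
have mux : 0 < mu `^ x by apply: powR_gt0.
apply: (@le_trans _ _ (M * ((1 - x) * mu `^ x) + x * mu `^ (x - 1) * (M * mu))).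
  apply: lerD; last by rewrite ler_pM2l // mulr_gt0.
  by rewrite -mulr_natl ler_pM2r // mulr_gt0 // subr_gt0.
rewrite (_ : _ * (M * mu) = M * x * (mu `^ (x - 1) * mu)); last by ring.
have -> : mu `^ (x - 1) * mu = mu `^ x.
  by rewrite -{2}[mu]powRr1 ?ltW // -powRD ?(gt_eqF mu0) ?implybT // subrK.
by rewrite (_ : _ + _ = M * mu `^ x) //; ring.
Qed.

Section RegionSize.
Variables (R : realType) (Delta d c : nat) (G : network node_input).
Hypotheses (wf : wf_network c G) (tG : is_tree (@edge _ G)).
Hypotheses (deg : max_degree_le (@edge _ G) Delta).
Hypotheses (d_gt0 : (0 < d)%N) (Delta_ge : (d + 3 <= Delta)%N).
Variables (x C : R).
Hypotheses (x01 : 0 < x < 1) (C2 : 2 <= C) (Cx : 1 <= C * (1 - (2^-1) `^ x)).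
Hypothesis efficiencyE : (Delta - 1)%N%:R `^ x = (Delta - d - 1)%N%:R :> R.

(** The reason for the choice of [x]: at most [Delta - d - 1] subtrees remain, with at most that
    share of [S / (Delta - 1)] each on average, and [(Delta - d - 1) * (S / (Delta - 1))]^ x = S
    [^ x]. *)
Lemma sorted_drop_powR (T : eqType) (f : T -> nat) (s : seq T) :
  sorted (fun a b => f b <= f a)%N s -> (size s < Delta)%N ->
  \sum_(u <- drop d s) (f u)%:R `^ x <= (\sum_(u <- s) f u)%N%:R `^ x :> R.
Proof.
move=> srt sD; have /andP[x0 x1] := x01.
have [S0|S0] := posnP (\sum_(u <- s) f u)%N.
  rewrite S0 big_seq big1 => [|u ud]; first exact: powR_ge0.
  have : (f u <= 0)%N by rewrite -S0 (big_rem u (mem_drop ud)) /= leq_addr.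
  by rewrite leqn0 => /eqP ->; rewrite powR0 // gt_eqF.
pose D := (Delta - 1)%N; have D0 : 0 < D%:R :> R by rewrite ltr0n /D; lia.
pose mu : R := (\sum_(u <- s) f u)%N%:R / D%:R.
have mu0 : 0 < mu by rewrite divr_gt0 // ltr0n.
have := @sum_powR_le R T (drop d s) (fun u => (f u)%:R) x mu (Delta - d - 1)%N%:R x01 mu0.
move/(_ (fun i => ler0n _ _)) => H; apply: le_trans (H _ _) _ => {H}.
- by rewrite ler_nat size_drop; lia.
- rewrite /mu mulrA ler_pdivlMr // -natr_sum -!natrM ler_nat mulnC.
  have := @sorted_drop_sum T f s d (Delta - d - 1) srt.
  have -> : (Delta - d - 1 + d = D)%N by rewrite /D; lia.
  by apply; rewrite /D; lia.
- rewrite -efficiencyE -/D -powRM ?(ltW D0) ?(ltW mu0) //.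
  by rewrite /mu mulrC divfK // gt_eqF.
Qed.

(* The [- 1] absorbs the root of each of several copied subtrees; if only one
   subtree is copied, it has at most half of the nodes. *)
Lemma region_size t (v : node G) p : ~~ act v ->
  contact v \/ (exists2 u, p = Some (ident u) & edge v u) ->
  (size (region d t v p))%:R <= C * (size (subtree t v p))%:R `^ x - 1.
Proof.
have /andP[x0 x1] := x01; have C0 : 0 < C by apply: lt_le_trans C2.
elim: t v p => [|t IH] v p av vp.
  by rewrite /= powR1; move: C2; lra.
have half := @subtree_halves d G t v p.
rewrite size_regionS size_subtreeS; set S := (\sum_(u <- by_size t v p) _)%N.
have Sx : 1 <= S.+1%:R `^ x :> R.
  have p1 : 1 `^ x = 1 :> R by rewrite powR1.
  by rewrite -[leLHS]p1 ge0_ler_powR ?nnegrE ?ler0n ?(ltW x0) // ler1n.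
have srt := by_size_sorted t v p.
have := sorted_drop_powR srt (size_by_size wf deg t vp); rewrite -/S => HS.
have IHu u : u \in drop d (by_size t v p) ->
    (size (region d t u (Some (ident v))))%:R <=
    C * (size (subtree t u (Some (ident v))))%:R `^ x - 1.
  move=> /mem_drop; rewrite (mem_by_size wf) => /and3P[evu au _]; apply: IH => //.
  by right; exists v => //; have [_ es _ _ _] := tG; rewrite es.
rewrite -natr1 natr_sum.
move: Sx; have -> : S.+1%:R `^ x = (size (subtree t.+1 v p))%:R `^ x :> R by rewrite size_subtreeS.
have SS : S%:R `^ x <= (size (subtree t.+1 v p))%:R `^ x :> R.
  by rewrite ge0_ler_powR ?nnegrE ?ler0n ?(ltW x0) // ler_nat size_subtreeS leqnSn.
case: (drop _ _) half HS IHu => [|u [|u' s]] half HS IHu Sx.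
- by rewrite big_nil add0r lerBrDr; move: C2 Sx C0; nra.
(* The only copied subtree has at most half of the nodes, and [Cx] then pays for the root. *)
- rewrite big_cons big_nil addr0.
  have ux : (size (subtree t u (Some (ident v))))%:R `^ x
      <= (2^-1) `^ x * (size (subtree t.+1 v p))%:R `^ x :> R.
    rewrite -powRM ?invr_ge0 ?ler0n // ge0_ler_powR ?nnegrE ?mulr_ge0 ?invr_ge0 ?ler0n ?(ltW x0) //.
    rewrite -ler_pdivrMl ?invr_gt0 // invrK -natrM ler_nat ltnW //.
    by apply: half => //; rewrite mem_head.
  have := IHu u (mem_head _ _); move: Cx Sx ux C0.
  set h := _ `^ x; set b := _ `^ x; set e := _ `^ x => C1 b1 eb C0 H.
  have Ce : C * e <= C * (h * b) by rewrite ler_pM2l.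
  have Cb : 1 <= C * (1 - h) * b.
    by apply: le_trans C1 _; rewrite ler_peMr // (le_trans ler01).
  by move: H Ce Cb; rewrite -/e; nra.
- have : \sum_(w <- [:: u, u' & s]) (size (region d t w (Some (ident v))))%:R
      <= \sum_(w <- [:: u, u' & s])
           (C * (size (subtree t w (Some (ident v))))%:R `^ x - 1) :> R.
    rewrite big_seq [leRHS]big_seq; apply: ler_sum => w; exact: IHu.
  rewrite big_split /= -mulr_sumr big_const_seq count_predT iter_addr addr0 => H1.
  have H2 : C * \sum_(w <- [:: u, u' & s]) (size (subtree t w (Some (ident v))))%:R `^ x
      <= C * (size (subtree t.+1 v p))%:R `^ x.
    by rewrite ler_pM2l // (le_trans HS SS).
  (* There are at least two summands [- 1]: one pays for the root, another gives the [- 1] of the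
     claim. *)
  have H3 : (-1) *+ size [:: u, u' & s] <= - 2%:R :> R.
    by rewrite mulNrn lerN2 ler_nat.
  by move: H1 H2 H3; set a := \sum_(w <- _) _; set b := \sum_(w <- _) _; lra.
Qed.

End RegionSize.

(** * Balancing the exponents *)

Section Exponents.
Variables (R : realType) (Delta d k : nat).
Hypotheses (d_gt0 : (0 < d)%N) (k_gt0 : (0 < k)%N) (Delta_ge : (d + 3 <= Delta)%N).

Let x := efficiency R Delta d.
Let y := 2 - x.
Let alpha := alpha1 R Delta d k.

Let Delta1E : Delta%:R - 1 = (Delta - 1)%N%:R :> R.
Proof. by rewrite natrB //; lia. Qed.

Let DeltadE : Delta%:R - d%:R - 1 = (Delta - d - 1)%N%:R :> R.
Proof. by rewrite !natrB //; lia. Qed.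

Lemma efficiency_itv : 0 < x < 1.
Proof.
rewrite /x /efficiency Delta1E DeltadE.
have l0 : 0 < ln (Delta - d - 1)%N%:R :> R by rewrite ln_gt0 // ltr1n; lia.
have l1 : ln (Delta - d - 1)%N%:R < ln (Delta - 1)%N%:R :> R.
  by rewrite ltr_ln ?posrE ?ltr0n ?ltr_nat; lia.
have l2 := lt_trans l0 l1.
by apply/andP; split; [rewrite divr_gt0|rewrite ltr_pdivrMr ?mul1r].
Qed.

Lemma powR_efficiency : (Delta - 1)%N%:R `^ x = (Delta - d - 1)%N%:R :> R.
Proof.
have D0 : 1 < (Delta - 1)%N%:R :> R by rewrite ltr1n; lia.
rewrite /powR gt_eqF ?(lt_trans ltr01) // /x /efficiency Delta1E DeltadE.
by rewrite divfK ?lnK ?posrE ?ltr0n //; [lia|rewrite gt_eqF // ln_gt0].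
Qed.

Lemma y_itv : 1 < y < 2.
Proof. by have /andP[x0 x1] := efficiency_itv; rewrite /y; apply/andP; split; lra. Qed.

Lemma y_gt0 : 0 < y.
Proof. by have /andP[/(lt_trans ltr01)] := y_itv. Qed.

(** [alpha * weight_sum j] is the exponent of [n] by which the number of free nodes has dropped
    after [j] stages; at [j = k] it equals 1. *)
Definition weight_sum (j : nat) : R := \sum_(l < j) y ^+ l.

Lemma weight_sumS j : weight_sum j.+1 = weight_sum j + y ^+ j.
Proof. by rewrite /weight_sum big_ord_recr. Qed.

Lemma alphaE : alpha * weight_sum k = 1.
Proof.
rewrite /alpha /alpha1 big_mkord mulVf // gt_eqF //.
case: k k_gt0 => // k' _; rewrite big_ord_recl expr0.
by rewrite ltr_pwDl // sumr_ge0 // => i _; rewrite exprn_ge0 // ltW // y_gt0.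
Qed.

Lemma weight_sum_ge0 j : 0 <= weight_sum j.
Proof.
by rewrite sumr_ge0 // => i _; rewrite exprn_ge0 // ltW // y_gt0.
Qed.

Lemma alpha_gt0 : 0 < alpha.
Proof. by have := weight_sum_ge0 k; have := alphaE; nra. Qed.

(** A geometric sum, since [y - 1 = 1 - x]. *)
Lemma weight_sum_geometric j : (1 - x) * weight_sum j = y ^+ j - 1.
Proof. by rewrite subrX1 /weight_sum /y; congr (_ * _); ring. Qed.

(** The factor 2 cancels the two edges that may leave a component in [card_free_set_step]. *)
Definition gam (n l : nat) : nat := Num.truncn (2 * n%:R `^ (alpha * y ^+ l.-1)).
Definition rad (n : nat) : nat := (trunc_log 2 n).+1.
Definition conn (n : nat) : nat := (2 * rad n).+1.
Definition stage (i : nat) (G : network node_input) (v : node G) : option node_output :=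
  rule_output d (rad #|node G|) (conn #|node G|) (stage_label k (gam #|node G|) i) v.
Definition radius (n i : nat) : nat :=
  (lam_radius k (gam n) i k).+1 + ((conn n).+1 + conn n) + rad n + rad n.

Lemma lt_rad n : (n < 2 ^ rad n)%N.
Proof. exact: trunc_log_ltn. Qed.

Lemma rad_le n : (0 < n)%N -> (rad n)%:R <= (1 + (alpha * ln 2)^-1) * n%:R `^ alpha :> R.
Proof.
move=> n0; have n1 : 1 <= n%:R :> R by rewrite ler1n.
have a0 := alpha_gt0; have l2 : 0 < ln 2 :> R by rewrite ln_gt0 // ltr1n.
have na : 1 <= n%:R `^ alpha :> R by rewrite -[leLHS](powRr0 n%:R) ler_powR // ltW.
have tl : (trunc_log 2 n)%:R * ln 2 <= ln n%:R :> R.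
  rewrite mulr_natl -lnXn // ler_ln ?posrE ?exprn_gt0 ?ltr0n //.
  by rewrite -natrX ler_nat trunc_logP.
have ea : alpha * ln n%:R <= n%:R `^ alpha.
  rewrite /powR gt_eqF ?ltr0n //; apply: le_trans (expR_ge1Dx _); lra.
have -> : (rad n)%:R = 1 + (trunc_log 2 n)%:R :> R by rewrite /rad -natr1 addrC.
rewrite mulrDl mul1r lerD // -ler_pdivrMl ?invr_gt0 ?mulr_gt0 //.
rewrite invrK; apply: le_trans ea; rewrite -mulrA ler_pM2l //.
by rewrite mulrC.
Qed.

Lemma gam_le n l : (gam n l.+1)%:R <= 2 * n%:R `^ (alpha * y ^+ l).
Proof. by rewrite /gam truncn_le mulr_ge0 // powR_ge0. Qed.

Lemma expo_le i j : (i <= j)%N -> alpha * y ^+ i <= alpha * y ^+ j.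
Proof.
move=> ij; rewrite ler_pM2l ?alpha_gt0 // ler_weXn2l //.
by have /andP[/ltW] := y_itv.
Qed.

(** The largest threshold explored up to stage [i] is [gam n i]. At [i = 0] nothing is explored, and
    the exponent is [alpha] because [0.-1 = 0]. *)
Lemma radius_le : exists C : R, forall n i, (0 < n)%N ->
  (radius n i)%:R <= C * n%:R `^ (alpha * y ^+ i.-1).
Proof.
pose cr : R := 1 + (alpha * ln 2)^-1.
exists (2 * k%:R + 2 * k%:R + 4 + 6 * cr) => n i n0.
have n1 : 1 <= n%:R :> R by rewrite ler1n.
set P := n%:R `^ _.
have P1 : 1 <= P.
  by rewrite -[leLHS](powRr0 n%:R) ler_powR // mulr_ge0 ?exprn_ge0 ?ltW ?alpha_gt0 ?y_gt0.
have P0 : 0 < P := lt_le_trans ltr01 P1.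
have radP : (rad n)%:R <= cr * P.
  apply: le_trans (rad_le n0) _; rewrite ler_pM2l.
    rewrite ler_powR // -[leLHS]mulr1 -(expr0 y); exact: expo_le.
  by rewrite addr_gt0 // invr_gt0 mulr_gt0 ?alpha_gt0 // ln_gt0 // ltr1n.
have lamP : (\sum_(l < k | (l < i)%N) gam n l.+1)%N%:R <= 2 * k%:R * P.
  rewrite natr_sum; apply: (@le_trans _ _ (\sum_(l < k | (l < i)%N) 2 * P)).
    apply: ler_sum => l li; apply: le_trans (gam_le _ _) _.
    by rewrite ler_pM2l // ler_powR // expo_le //; lia.
  rewrite sumr_const -[leLHS]mulr_natr [leRHS](_ : _ = 2 * P * k%:R); last by ring.
  rewrite ler_pM2l ?mulr_gt0 // ler_nat.
  by apply: leq_trans (max_card _) _; rewrite card_ord.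
have -> : (radius n i = 2 * k + (\sum_(l < k | (l < i)%N) gam n l.+1) + 4 + 6 * rad n)%N.
  by rewrite /radius /lam_radius /conn; lia.
rewrite !natrD !natrM.
have k0 : 0 <= k%:R :> R by [].
nra.
Qed.

Lemma local_stage i (G G' : network node_input) (v : node G) (v' : node G') :
  view_at (radius #|node G| i) v = view_at (radius #|node G| i) v' ->
  stage i v = stage i v'.
Proof.
move=> E; rewrite /stage -(view_at_card E).
exact: (local_rule_output d (@local_stage_label k (gam #|node G|) i) E).
Qed.

Section OnTree.
Variables (c : nat) (G : network node_input).
Hypotheses (wf : wf_network c G) (tG : is_tree (@edge _ G)).
Hypothesis deg : max_degree_le (@edge _ G) Delta.

Let n := #|node G|.
Let g := gam n.

Let n_gt0 : (0 < n)%N. Proof. by case: tG. Qed.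
Let nR_ge1 : 1 <= n%:R :> R. Proof. by rewrite ler1n. Qed.
Let nR_gt0 : 0 < n%:R :> R. Proof. by rewrite ltr0n. Qed.
Let conn_rad : (2 * rad n < conn n)%N. Proof. by []. Qed.

Let powRDn a b : n%:R `^ a * n%:R `^ b = n%:R `^ (a + b) :> R.
Proof. by rewrite powRD // (gt_eqF nR_gt0) implybT. Qed.

Lemma free_set_le j : (j < k)%N ->
  #|@free_set k g G j|%:R <= n%:R `^ (1 - alpha * weight_sum j).
Proof.
elim: j => [_|j IH jk].
  by rewrite /weight_sum big_ord0 mulr0 subr0 powRr1 // ler_nat max_card.
have step := card_free_set_step g wf tG jk.
(* The successor absorbs the rounding in [gam]. *)
have g_ge : 2 * n%:R `^ (alpha * y ^+ j) <= (g j.+1).+1%:R by apply/ltW/truncnS_gt.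
have P0 : 0 < n%:R `^ (alpha * y ^+ j) :> R by apply: powR_gt0.
rewrite -(ler_pM2r P0) powRDn.
have -> : 1 - alpha * weight_sum j.+1 + alpha * y ^+ j = 1 - alpha * weight_sum j.
  by rewrite weight_sumS; ring.
apply: le_trans (IH (ltnW jk)).
move: step; rewrite -(ler_nat R) !natrM => step.
have : 0 <= #|@free_set k g G j.+1|%:R :> R by [].
by nra.
Qed.

(** As [alpha * weight_sum k = 1], the exponent left after [k - 1] stages is exactly that of the
    last threshold. This fixes [alpha]. *)
Lemma free_set_small : (#|@free_set k g G k.-1| <= g k)%N.
Proof.
rewrite /g /gam truncn_ge_nat ?mulr_ge0 ?powR_ge0 //.
apply: le_trans (free_set_le _) _; first by lia.
have -> : 1 - alpha * weight_sum k.-1 = alpha * y ^+ k.-1.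
  have W : weight_sum k = weight_sum k.-1 + y ^+ k.-1 by rewrite -weight_sumS prednK.
  by rewrite -[1]alphaE W; ring.
by rewrite ler_peMl ?powR_ge0 // ler1n.
Qed.

Lemma stage_mono i j (v : node G) o : (i <= j)%N ->
  stage i v = Some o -> stage j v = Some o.
Proof.
move=> ij; apply: (rule_output_mono wf tG conn_rad) => {}v l.
exact: stage_label_mono.
Qed.

Lemma stage_correct : exists2 out : node G -> node_output,
  forall v, stage k v = Some (out v) & weighted_correct (@edge _ G) (@input _ G) d k out.
Proof.
have total (v : node G) : isSome (stage k v).
  rewrite /stage; case: (boolP (act v)) => av.
    have := stage_label_total k g wf av; rewrite /rule_output av -/n -/g.
    by case: (stage_label _ _ _ _).
  case: (boolP (connects (conn n) v)) => [cv|ncv].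
    by rewrite /rule_output (negbTE av) cv.
  case: (rule_outputP d wf tG conn_rad (stage_label k g k) av ncv) => [[r [rr _ ->]]|-> //].
  have [_ ar] := source_active wf (copy_root_contact rr).
  by have := stage_label_total k g wf ar; case: (stage_label _ _ _ _).
have outP (v : node G) : {o | stage k v = Some o}.
  by case: (stage k v) (total v) => // o _; exists o.
exists (fun v => sval (outP v)) => [v|]; first exact: (svalP (outP v)).
apply: (rule_correct wf tG conn_rad (lab := stage_label k g k)).
- exact: lt_rad.
- exact: d_gt0.
- by move=> v av; apply: (stage_label_total k g wf av).
- by move=> v; exact: (svalP (outP v)).
- apply: (stage_label_correct wf tG k_gt0 free_set_small) => v av /=.
  case: (outP v) => o /=; rewrite /stage /rule_output av -/n -/g.
  by case: (stage_label _ _ _ _) => // l [<-].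
Qed.

(** Large enough for both conditions on [C] in [region_size]. *)
Let C0 : R := 2 + (1 - 2^-1 `^ x)^-1.
Let C3 : R := (k.+1 * 2 ^ k)%N%:R.

Let half_powR : 0 < 1 - 2^-1 `^ x :> R.
Proof.
have /andP[x0 _] := efficiency_itv; have l2 : 0 < ln 2 :> R by rewrite ln_gt0 // ltr1n.
rewrite subr_gt0 /powR gt_eqF ?invr_gt0 // lnV ?posrE // -[ltRHS]expR0 ltr_expR.
by rewrite mulrN oppr_lt0 mulr_gt0.
Qed.

Lemma region_size_le (r : node G) : copy_root (conn n) r ->
  (size (region d (rad n) r None))%:R <= C0 * (size (subtree (rad n) r None))%:R `^ x.
Proof.
move=> rr; have cr := copy_root_contact rr.
have C2 : 2 <= C0 by rewrite lerDl invr_ge0 ltW // half_powR.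
have Cx : 1 <= C0 * (1 - 2^-1 `^ x).
  by rewrite mulrDl mulVf ?gt_eqF // ?half_powR // lerDr mulr_ge0 // ltW // half_powR.
apply: le_trans (region_size wf tG deg d_gt0 Delta_ge efficiency_itv C2 Cx powR_efficiency
  (rad n) (contact_weight cr) (or_introl cr)) _.
by rewrite gerBl.
Qed.

Lemma unfinished_le i : (i < k)%N ->
  #|[set v : node G | ~~ isSome (stage i v)]|%:R <=
  (C3 + C0 * (Delta%:R * C3) `^ (1 - x)) * n%:R `^ (1 - alpha * (y ^+ i - 1)).
Proof.
move=> ik; have /andP[x0 x1] := efficiency_itv; have [/andP[y1 y2] a0] := (y_itv, alpha_gt0).
set beta := 1 - alpha * weight_sum i.
have betaE : beta * (1 - x) + x = 1 - alpha * (y ^+ i - 1).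
  by rewrite -weight_sum_geometric /beta; ring.
have C3_gt0 : 0 < C3 by rewrite ltr0n muln_gt0 expn_gt0.
have D0 : 0 < Delta%:R :> R by rewrite ltr0n; lia.
pose Z := undecided k g G i.
have Z_le : #|Z|%:R <= C3 * n%:R `^ beta.
  apply: (@le_trans _ _ (C3 * #|@free_set k g G i|%:R)).
    by rewrite -natrM ler_nat; apply: card_undecided wf tG i.
  by rewrite ler_pM2l // free_set_le.
(* As [beta <= 1], the exponent for the active nodes does not exceed that for the weight nodes. *)
have beta_le : n%:R `^ beta <= n%:R `^ (1 - alpha * (y ^+ i - 1)).
  rewrite ler_powR // -betaE.
  have aWx : 0 <= alpha * weight_sum i * x by exact: mulr_ge0 (mulr_ge0 (ltW a0) (weight_sum_ge0 i)) (ltW x0).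
  by rewrite /beta; nra.
pose M := Delta%:R * C3 * n%:R `^ beta.
have M0 : 0 < M by rewrite !mulr_gt0 ?powR_gt0.
pose roots := enum [set r : node G | copy_root (conn n) r & source r \in Z].
apply: (@le_trans _ _ (#|Z| + \sum_(r <- roots) size (region d (rad n) r None))%N%:R).
  rewrite ler_nat; apply: leq_trans (card_unfinished d wf tG conn_rad _) _.
  apply: leq_add => //; rewrite /roots big_enum /= leq_eqVlt; apply/orP; left.
  apply/eqP/eq_bigl => r; rewrite !inE; case: (boolP (copy_root _ r)) => //= rr.
  by have [_ ->] := source_active wf (copy_root_contact rr).
have roots_root r : r \in roots -> copy_root (conn n) r.
  by rewrite mem_enum inE => /andP[].
rewrite natrD natr_sum mulrDl; apply: lerD.
  by apply: le_trans Z_le _; rewrite ler_pM2l.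
pose mu := n%:R / M; have mu0 : 0 < mu by rewrite divr_gt0.
apply: (@le_trans _ _ (C0 * (M * mu `^ x))).
  apply: (@le_trans _ _ (\sum_(r <- roots) C0 * (size (subtree (rad n) r None))%:R `^ x)).
    rewrite big_seq [leRHS]big_seq; apply: ler_sum => r /roots_root.
    exact: region_size_le.
  rewrite -mulr_sumr ler_pM2l; last by rewrite addr_gt0 // invr_gt0 half_powR.
  apply: (sum_powR_le efficiency_itv mu0) => [r||]; first exact: ler0n.
    rewrite -cardE; apply: (@le_trans _ _ (Delta * #|Z|)%N%:R).
      by rewrite ler_nat; exact: (card_roots (conn n) wf tG deg Z).
    by rewrite natrM /M -mulrA ler_pM2l.
  rewrite mulrC divfK ?gt_eqF // -natr_sum ler_nat.
  apply: leq_trans (sum_subtrees wf tG conn_rad).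
  rewrite /roots big_enum big_mkcond [leqRHS]big_mkcond /=; apply: leq_sum => r _.
  by rewrite inE; case: (copy_root _ r) => //=; case: ifP.
have -> : M * mu `^ x = M `^ (1 - x) * n%:R `^ x.
  rewrite -{1}[M](powRr1 (ltW M0)) -{1}[1](subrK x) powRD ?(gt_eqF M0) ?implybT //.
  by rewrite -mulrA -powRM ?ltW // [M * mu]mulrC divfK ?gt_eqF.
have -> : M `^ (1 - x) = (Delta%:R * C3) `^ (1 - x) * n%:R `^ (beta * (1 - x)).
  by rewrite /M powRM ?powR_ge0 ?(ltW (mulr_gt0 D0 C3_gt0)) // -powRrM.
by rewrite -[_ * n%:R `^ x]mulrA powRDn betaE mulrA.
Qed.

(** A node that first gets its output at stage [i + 1] is unfinished at stage [i], so its time is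
    charged there. *)
Lemma sum_termination_le (T : node G -> R) :
  (forall v i, isSome (stage i v) -> T v <= (radius n i)%:R) ->
  \sum_v T v <= n%:R * (radius n 0)%:R +
     \sum_(i < k) (radius n i.+1)%:R * #|[set v : node G | ~~ isSome (stage i v)]|%:R.
Proof.
move=> H; apply: (@le_trans _ _ (\sum_v ((radius n 0)%:R + \sum_(i < k)
    (radius n i.+1)%:R * (~~ isSome (stage i v))%:R))).
  apply: ler_sum => v _.
  have [out outE _] := stage_correct; have ex : exists i, isSome (stage i v).
    by exists k; rewrite outE.
  have [[|i] si imin] := ex_minnP ex.
    by apply: le_trans (H v 0%N si) _; rewrite lerDl sumr_ge0 // => i _; rewrite mulr_ge0.
  have ik : (i < k)%N by apply: imin; rewrite outE.
  apply: le_trans (H v _ si) _; rewrite (bigD1 (Ordinal ik)) //=.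
  case: (boolP (isSome (stage i v))) => [/imin|_]; first by rewrite ltnn.
  by rewrite mulr1 addrCA lerDl addr_ge0 // sumr_ge0 // => j _; rewrite mulr_ge0.
rewrite big_split /= sumr_const -[leLHS]/(_ + _) mulr_natl lerD2l exchange_big /=.
apply: ler_sum => i _; rewrite -mulr_sumr -natr_sum ler_wpM2l // ler_nat.
rewrite -sum1dep_card [leqRHS]big_mkcond; apply: leq_sum => v _.
by case: (isSome _).
Qed.

End OnTree.

Lemma node_averaged_bound :
  node_averaged_bigO (Pi25 Delta d k) (fun n : nat => n%:R `^ alpha : R).
Proof.
move=> c _; have [C1 r_le] := radius_le.
have [C4 X_le] : exists C4 : R, forall c (G : network node_input) i, wf_network c G ->
    is_tree (@edge _ G) -> max_degree_le (@edge _ G) Delta -> (i < k)%N ->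
    #|[set v : node G | ~~ isSome (stage i v)]|%:R <=
    C4 * #|node G|%:R `^ (1 - alpha * (y ^+ i - 1)).
  by eexists => c' G i wf tG deg ik; apply: unfinished_le wf tG deg i ik.
have [A solA timeA] := @simulate _ _ (Pi25 Delta d k) c k stage radius
  (fun i G G' v v' E => local_stage E)
  (fun G wf iG v i j o ij => stage_mono wf (proj1 iG) ij)
  (fun G wf iG => stage_correct wf (proj1 iG)).
exists A => //; exists (C1 + k%:R * (C1 * C4)) => n n0.
apply: ge_ereal_sup => _ [G [wf iG nE ->]]; have [tG deg] := iG.
have nR0 : 0 < n%:R :> R by rewrite ltr0n.
have [out outE _] := stage_correct wf tG.
(* All nodes stop by stage [k], so the times are finite and the computation moves to real
   numbers. *)
have fin v : termination_time A R v = (fine (termination_time A R (v : node G)))%:E.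
  rewrite fineK // ge0_fin_numE.
    apply: le_lt_trans (ltry _); apply: (timeA G R v k wf iG); by rewrite outE.
  by apply: le_ereal_inf_tmp => _ [t _ <-]; rewrite lee_fin.
rewrite /average_time (eq_bigr _ (fun v _ => fin v)) sumEFin -EFinM lee_fin nE.
rewrite ler_pdivrMl // mulrC.
have T_le (v : node G) i : isSome (stage i v) ->
    fine (termination_time A R v) <= (radius #|node G| i)%:R.
  by move=> si; rewrite -lee_fin -fin; apply: timeA.
apply: le_trans (sum_termination_le wf tG T_le) _; rewrite nE.
have prod a b : n%:R `^ a * n%:R `^ b = n%:R `^ (a + b) :> R.
  by rewrite powRD // (gt_eqF nR0) implybT.
have total : n%:R `^ alpha * n%:R = n%:R `^ (1 + alpha) :> R.
  by rewrite -{2}[n%:R]powRr1 ?ltW // prod addrC.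
rewrite -mulrA total mulrDl; apply: lerD.
  have := r_le n 0%N n0; rewrite expr0 mulr1 => r0.
  by rewrite [leLHS]mulrC -total mulrA ler_pM2r.
have -> : k%:R * (C1 * C4) * n%:R `^ (1 + alpha)
    = \sum_(i < k) (C1 * C4) * n%:R `^ (1 + alpha).
  by rewrite sumr_const card_ord -mulrA mulr_natl.
apply: ler_sum => i _.
have := X_le c G i wf tG deg (ltn_ord i); rewrite nE => Xi.
(* The balance: the exponents [alpha * y ^+ i] and [1 - alpha * (y ^+ i - 1)] add up to [1 + alpha]
   at every stage. *)
apply: le_trans (ler_pM (ler0n _ _) (ler0n _ _) (r_le n i.+1 n0) Xi) _.
rewrite mulrACA prod /= (_ : _ + (1 - _) = 1 + alpha) //.
by ring.
Qed.

End Exponents.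

Theorem theorem2 (R : realType) (Delta d k : nat)
  (d_gt0 : (0 < d)%N) (k_gt0 : (0 < k)%N) (Delta_ge : (d + 3 <= Delta)%N) :
  node_averaged_bigO (Pi25 Delta d k) (fun n : nat => n%:R `^ alpha1 R Delta d k).
Proof. exact: node_averaged_bound. Qed.
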